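(* Let $(\alpha(i))_{i\in\mathbb{Z}}$ be independent and identically distributed positive random variables whose common law is not a point mass, and let $r=\inf\{s:\mathbb{P}[\alpha(i)\geq s]<1\}$ be the essential infimum of this law; assume $r>0$. Let $f$ be the flux function of TASEP with disorder $\alpha$ (defined in the context), and set $\mu=\frac{1}{r}-\mathbb{E}\!\left[\frac{1}{\alpha(i)}\right]$. Then for all $\rho\in\left[\frac12-\frac14\mu r,\ \frac12+\frac14\mu r\right]$, \[ f(\rho)=\frac{r}{4}. \]
   Context: TASEP with disorder $\alpha$: configurations are elements of $\{0,1\}^{\mathbb{Z}}$ (indicators of particles at sites). If site $i$ is occupied and site $i+1$ is empty, the particle at $i$ jumps to $i+1$ according to a Poisson clock of rate $\alpha(i)$, independently over bonds. The flux $f(\rho)$ is the long-run rate at which particles cross a bond at macroscopic density $\rho\in[0,1]$; it is given by the following last-passage percolation formula. Let $\mathcal{W}=\{(i,j)\in\mathbb{Z}^2: j\geq 0,\ i+j\geq 0\}$ and, given the disorder, let $Y_{ij}$, $(i,j)\in\mathcal{W}$, be independent exponential random variables with rate $\alpha(i)$. A path from $x$ to $y$ in $\mathcal{W}$ is a sequence of vertices $x=(i_0,j_0),\dots,(i_k,j_k)=y$ in $\mathcal{W}$ with $(i_\ell-i_{\ell-1},j_\ell-j_{\ell-1})\in\{(1,0),(-1,1)\}$. Let $\Gamma_{i,j}$ be the set of paths from $(0,0)$ to $(i,j)$ and $T(i,j)=\max_{\gamma\in\Gamma_{i,j}}\sum_{(i',j')\in\gamma}Y_{i'j'}$. For $(x,y)$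 with $y\ge 0$, $x+y\ge 0$, $\tau(x,y)=\lim_{n\to\infty}\frac1n T(\lfloor xn\rfloor,\lfloor yn\rfloor)$, which exists almost surely and is deterministic. Set $h(t,x)=\inf\{y\ge 0:\tau(x,y)>t\}$, which satisfies $h(t,x)=t\,k(x/t)$ for a function $k$, and $f(\rho)=\inf_{v\in\mathbb{R}}[k(v)+v\rho]$. *)

(* Defs.v *)
From HB Require Import structures.
From mathcomp Require Import all_boot all_order all_algebra.
From mathcomp Require Import all_classical all_reals all_analysis.
From mathcomp Require Import finmap.
Set Implicit Arguments. Unset Strict Implicit. Unset Printing Implicit Defensive.
Import Order.TTheory GRing.Theory Num.Theory.
Import numFieldNormedType.Exports.
Local Open Scope classical_set_scope.
Local Open Scope ring_scope.

Definition mutually_independent d (T : measurableType d) (R : realType)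
  (P : probability T R) (I : choiceType) (X : I -> T -> R) : Prop :=
  forall (F : {fset I}) (B : I -> set R), (forall i, measurable (B i)) ->
    P (\bigcap_(i in [set` F]) (X i @^-1` B i)) =
      (\prod_(i <- F) P (X i @^-1` B i))%E.

Definition same_law d (T : measurableType d) (R : realType)
  (P : probability T R) (X Z : T -> R) : Prop :=
  forall B : set R, measurable B -> P (X @^-1` B) = P (Z @^-1` B).

Definition exp_law d (T : measurableType d) (R : realType)
  (P : probability T R) (rate : R) (X : T -> R) : Prop :=
  forall B : set R, measurable B -> P (X @^-1` B) = exponential_prob rate B.

Definition inW (p : int * int) : bool := (0 <= p.2) && (0 <= p.1 + p.2).

Definition lpp_step (p q : int * int) : bool :=
  (q == (p.1 + 1, p.2)) || (q == (p.1 - 1, p.2 + 1)).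

Definition lpp_path (z : int * int) (g : seq (int * int)) : bool :=
  [&& path lpp_step (0, 0) g, last (0, 0) g == z & all inW ((0, 0) :: g)].

(* Last-passage time T(z) = max over paths of the sum of weights of the
   visited vertices (the set of paths is finite and nonempty for z in W). *)
Definition lpp_T (R : realType) (Y : int -> int -> R) (z : int * int) : R :=
  sup [set \sum_(p <- (0, 0) :: g) Y p.1 p.2 | g in [set g | lpp_path z g]].

(* The lattice point (floor(xn), floor(yn)), pushed into W if the rounding
   makes it leave W. *)
Definition scaled_pt (R : realType) (x y : R) (n : nat) : int * int :=
  let j := Num.floor (y * n%:R) in (Num.max (Num.floor (x * n%:R)) (- j), j).

(* k(v) = h(1, v) = inf{ y >= 0 : tau(v, y) > 1 } (over the domain of tau). *)
Definition k_of (R : realType) (tau : R -> R -> R) (v : R) : \bar R :=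
  ereal_inf [set y%:E | y in [set y | 0 <= y /\ 0 <= v + y /\ 1 < tau v y]].

Definition flux (R : realType) (tau : R -> R -> R) (rho : R) : \bar R :=
  ereal_inf [set (k_of tau v + (v * rho)%:E)%E | v in [set: R]].

(* Main.v *)
Require Import Defs.
From HB Require Import structures.
From mathcomp Require Import all_boot all_order all_algebra.
From mathcomp Require Import all_classical all_reals all_analysis.
From mathcomp Require Import finmap zify ring lra measurable_realfun.
Import Order.TTheory GRing.Theory Num.Theory.
Import numFieldNormedType.Exports.
Local Open Scope classical_set_scope.
Local Open Scope ring_scope.

(** In the coordinates [(m, n)] of the site [(m - n, n)], [T] is last-passage
percolation on the quadrant, with exponential weights of rate [alpha i] on the
diagonal [m - n = i].

For unit rates, give the weights of the two axes means [s] and [t] with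
[1/s + 1/t = 1]: the increments of the passage time are then stationary (Burke
property), so its mean at [(m, n)] is [m s + n t]. Taking [s = t = 2] bounds the
mean without boundary by [2 (m + n)]. Conversely the passage time is convex in
the means of the axes, its mean at [(n, n)] is [4 n] when both are [2] and at
most [(4 + O(h^2)) n + O(1)] when both are [2 + h], by comparison with the
stationary models [(2 + h, t)] and [(t, 2 + h)]; so it is at least
[(4 - O(h)) n - O(1)] when both are [1].

In an environment bounded below by [r], an exponential variable of mean
[1 / alpha] plus [1 / r - 1 / alpha] is dominated in the convex order by one of
mean [1 / r], and a path from column [0] to column [x n] collects the excess
[1 / r - 1 / alpha i] of all columns in between. Averaging over the environment,
[tau x y <= 2 (x + 2 y) / r - mu |x|]. On the other hand, with positive
probability the rates are at most [r + eps] on any given stretch around the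
origin, and paths confined to that stretch show [tau 0 y >= 4 y / r]. The first
bound gives [k v + v rho >= r / 4] for [rho] in the given interval, the second
[k 0 <= r / 4]. *)

(** Two obstacles shape the argument. Comparing the axes [(2 + h, 2 + h)] with two stationary models
    goes through the maximum of two passage times, whose mean exceeds the larger mean by the size of
    the fluctuations; hence second moments are carried along with the means, and the additive
    constants of order [1 / h ^ 2] are variances measured at the scale [h ^ 2 n]. The error of the
    means is quadratic in [h] because [s = t = 2] minimises [s + t] under [1/s + 1/t = 1]; the
    convexity step then divides by [h] and leaves a linear error.

    Moreover, [tau] is only an almost sure limit, so expectations cannot be passed to the limit
    directly: passage times are truncated. In the upper bound the truncation level is [tau x y]
    itself; in the lower bound it is applied block by block, at a level that depends on [eps] alone.
    As [tau] is deterministic, a single environment with a slow stretch suffices for the lower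
    bound, however unlikely that stretch is. *)

Local Notation RT R := (measurableTypeR R).

(** * Last-passage percolation on the quadrant *)

Section lpp.
Context {R : realType}.
Implicit Types w u : nat -> nat -> R.

(** The row comes first: [lpp w n m] is the passage time to the vertex in column [m] and row [n],
    whose weight is [w m n]. Weights of both end vertices are counted. *)
Fixpoint lpp w (n m : nat) {struct n} : R :=
  match n with
  | 0 => \sum_(0 <= k < m.+1) w k 0%N
  | n'.+1 => (fix go m := match m with
      | 0 => lpp w n' 0%N + w 0%N n'.+1
      | m'.+1 => Num.max (go m') (lpp w n' m'.+1) + w m'.+1 n'.+1
      end) m
  end.

Lemma lpp00 w : lpp w 0 0 = w 0%N 0%N.
Proof. by rewrite /= big_nat1. Qed.

Lemma lppS0 w m : lpp w 0 m.+1 = lpp w 0 m + w m.+1 0%N.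
Proof. by rewrite /= big_nat_recr. Qed.

Lemma lpp0S w n : lpp w n.+1 0 = lpp w n 0 + w 0%N n.+1.
Proof. by []. Qed.

Lemma lppSS w n m :
  lpp w n.+1 m.+1 = Num.max (lpp w n.+1 m) (lpp w n m.+1) + w m.+1 n.+1.
Proof. by []. Qed.

Arguments lpp : simpl never.

Lemma lpp_ind (Q : nat -> nat -> Prop) :
  Q 0%N 0%N -> (forall m, Q 0%N m -> Q 0%N m.+1) -> (forall n, Q n 0%N -> Q n.+1 0%N) ->
  (forall n m, Q n.+1 m -> Q n m.+1 -> Q n.+1 m.+1) -> forall n m, Q n m.
Proof.
move=> Q00 Q0 QS QSS; elim=> [|n IHn]; elim=> [|m IHm]; auto.
Qed.

Lemma le_lpp w u n m : (forall i j, (i <= m)%N -> (j <= n)%N -> w i j <= u i j) ->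
  lpp w n m <= lpp u n m.
Proof.
move: n m; apply: lpp_ind => [|m IH|n IH|n m IH1 IH2] wu.
- by rewrite !lpp00 wu.
- by rewrite !lppS0 lerD ?wu ?IH// => i j im jn; rewrite wu// ltnW.
- by rewrite !lpp0S lerD ?wu ?IH// => i j im jn; rewrite wu// ltnW.
- rewrite !lppSS lerD ?wu// le_max2 ?IH1 ?IH2// => i j im jn; rewrite wu// ltnW//.
Qed.

Lemma eq_lpp w u n m : (forall i j, (i <= m)%N -> (j <= n)%N -> w i j = u i j) ->
  lpp w n m = lpp u n m.
Proof.
by move=> wu; apply/eqP; rewrite eq_le !le_lpp// => i j im jn; rewrite wu.
Qed.

Lemma lpp_ge0 w n m : (forall i j, 0 <= w i j) -> 0 <= lpp w n m.
Proof.
move=> w0; move: n m; apply: lpp_ind => [|m IH|n IH|n m IH1 IH2].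
- by rewrite lpp00.
- by rewrite lppS0 addr_ge0.
- by rewrite lpp0S addr_ge0.
- by rewrite lppSS addr_ge0// le_max IH1.
Qed.

Lemma lpp_ler w n m : (forall i j, 0 <= w i j) -> lpp w n m <= lpp w n m.+1.
Proof.
move=> w0; case: n => [|n]; first by rewrite lppS0 lerDl.
by rewrite lppSS -[leLHS]addr0 lerD// le_max lexx.
Qed.

Lemma lpp_leu w n m : (forall i j, 0 <= w i j) -> lpp w n m <= lpp w n.+1 m.
Proof.
move=> w0; case: m => [|m]; first by rewrite lpp0S lerDl.
by rewrite lppSS -[leLHS]addr0 lerD// le_max lexx orbT.
Qed.

Lemma lpp_stepr w n m : lpp w n m + w m.+1 n <= lpp w n m.+1.
Proof.
case: n => [|n]; first by rewrite lppS0.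
by rewrite lppSS lerD2r le_max lexx.
Qed.

Lemma lpp_stepu w n m : lpp w n m + w m n.+1 <= lpp w n.+1 m.
Proof.
case: m => [|m]; first by rewrite lpp0S.
by rewrite lppSS lerD2r le_max lexx orbT.
Qed.

Lemma lppZ w (c : R) n m : 0 <= c ->
  lpp (fun i j => c * w i j) n m = c * lpp w n m.
Proof.
move=> c0; move: n m; apply: lpp_ind => [|m IH|n IH|n m IH1 IH2].
- by rewrite !lpp00.
- by rewrite !lppS0 IH mulrDr.
- by rewrite !lpp0S IH mulrDr.
- by rewrite !lppSS IH1 IH2 mulrDr maxr_pMr.
Qed.

Lemma lpp_subadd w u n m :
  lpp (fun i j => w i j + u i j) n m <= lpp w n m + lpp u n m.
Proof.
move: n m; apply: lpp_ind => [|m IH|n IH|n m IH1 IH2].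
- by rewrite !lpp00.
- by rewrite !lppS0 addrACA lerD2r.
- by rewrite !lpp0S addrACA lerD2r.
- rewrite !lppSS addrACA lerD2r ge_max; apply/andP; split.
    by rewrite (le_trans IH1)// lerD// le_max lexx.
  by rewrite (le_trans IH2)// lerD// le_max lexx orbT.
Qed.

(** [delta] grows along each step by at most the weight [d] of the vertex entered, so every path to
    [(m, n)] collects at least [delta m n] from [d]. *)
Lemma lpp_add_potential w (d delta : nat -> nat -> R) n m :
  delta 0%N 0%N <= d 0%N 0%N ->
  (forall i j, delta i.+1 j <= delta i j + d i.+1 j) ->
  (forall i j, delta i j.+1 <= delta i j + d i j.+1) ->
  lpp w n m + delta m n <= lpp (fun i j => w i j + d i j) n m.
Proof.
move=> d0 dr du; move: n m; apply: lpp_ind => [|m IH|n IH|n m IH1 IH2].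
- by rewrite !lpp00 lerD2l.
- by have := dr m 0%N; rewrite !lppS0; lra.
- by have := du 0%N n; rewrite !lpp0S; lra.
- have := dr m n.+1; have := du m.+1 n; move: IH1 IH2; rewrite !lppSS.
  set A := lpp w n.+1 m; set B := lpp w n m.+1.
  set A' := lpp _ n.+1 m; set B' := lpp _ n m.+1.
  by have [] := leP A B; have [] := leP A' B'; lra.
Qed.

(** Concatenation of paths: passing from [(p, q)] to [(p.+1, q.+1)] visits one further vertex, whose
    nonnegative weight is dropped. *)
Lemma lpp_superadd w p q n m : (forall i j, 0 <= w i j) ->
  lpp w q p + lpp (fun i j => w (p.+1 + i)%N (q.+1 + j)%N) n m
    <= lpp w (q.+1 + n) (p.+1 + m).
Proof.
move=> w0; move: n m; apply: lpp_ind => [|m IH|n IH|n m IH1 IH2].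
- rewrite lpp00 !addn0 lppSS lerD2r le_max.
  by rewrite (le_trans (lpp_leu _ _ _ w0)).
- rewrite lppS0 !addnS addrA (le_trans _ (lpp_stepr _ _ _))//.
  by rewrite -addnS lerD2r.
- rewrite lpp0S !addnS addrA (le_trans _ (lpp_stepu _ _ _))//.
  by rewrite -!addnS lerD2r.
- rewrite lppSS addrA !addnS lppSS lerD2r addr_maxr ge_max !le_max.
  by rewrite -!addnS IH1 IH2 orbT.
Qed.

(** The model with boundary: for weights of mean one, the horizontal axis has mean [s] and the
    vertical axis mean [t]. The origin has weight 0, so that passage times are sums of
    increments. *)
Definition bdw (s t : R) w (i j : nat) : R :=
  match i, j with
  | 0, 0 => 0 | i'.+1, 0 => s * w i 0%N | 0, j'.+1 => t * w 0%N j
  | i'.+1, j'.+1 => w i j end.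

Lemma lpp_le_bdw s t w n m : (forall i j, 0 <= w i j) -> 1 <= s -> 1 <= t ->
  lpp w n m <= lpp (bdw s t w) n m + w 0%N 0%N.
Proof.
move=> w0 s1 t1; move: n m; apply: lpp_ind => [|m IH|n IH|n m IH1 IH2].
- by rewrite !lpp00 add0r.
- have := w0 m.+1 0%N; rewrite !lppS0 /=; nra.
- have := w0 0%N n.+1; rewrite !lpp0S /=; nra.
- rewrite !lppSS /= addrAC lerD2r ge_max.
  rewrite (le_trans IH1) ?lerD2r ?le_max ?lexx//=.
  by rewrite (le_trans IH2)// ?lerD2r ?le_max ?lexx ?orbT.
Qed.

Lemma bdw1_le w n m : (forall i j, 0 <= w i j) ->
  lpp (bdw 1 1 w) n m <= lpp w n m.
Proof. by move=> w0; apply: le_lpp => -[|i] [|j] _ _ /=; rewrite ?mul1r. Qed.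

(** A path leaves the origin along one axis and never visits the other one, whose parameter can
    therefore be changed to [t]. *)
Lemma lpp_bdw_max s t w n m : lpp (bdw s s w) n m <=
  Num.max (lpp (bdw s t w) n m) (lpp (bdw t s w) n m).
Proof.
move: n m; apply: lpp_ind => [|m IH|n IH|n m IH1 IH2].
- by rewrite !lpp00 /= le_max lexx.
- rewrite le_max; apply/orP; left; rewrite [leRHS](@eq_lpp _ (bdw s s w))//.
  by move=> [|i] [|j].
- rewrite le_max; apply/orP; right; rewrite [leRHS](@eq_lpp _ (bdw s s w))//.
  by move=> [|i] [|j].
- rewrite !lppSS /= -addr_maxl lerD2r maxACA ge_max.
  by rewrite (le_trans IH1) ?(le_trans IH2)// le_max lexx ?orbT.
Qed.

(** The weights agree pointwise, since [(1 + h) * 2 = h * 1 + (2 + h)] on the axes; the passage time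
    is homogeneous and subadditive in the weights. *)
Lemma lpp_bdw_convex h w n m : 0 <= h ->
  (1 + h) * lpp (bdw 2 2 w) n m <=
  h * lpp (bdw 1 1 w) n m + lpp (bdw (2 + h) (2 + h) w) n m.
Proof.
move=> h0; rewrite -!lppZ ?addr_ge0//.
rewrite (le_trans _ (lpp_subadd _ _ _ _))// le_lpp// => -[|i] [|j] _ _ /=; lra.
Qed.

(* increments of [lpp (bdw s t w)]: [incH k n] over the horizontal edge ending
   at (k, n) and [incV k n] over the vertical edge ending at (k, n) *)
Fixpoint incHV (s t : R) w (k n : nat) {struct n} : R * R :=
  match n with
  | 0 => (s * w k 0%N, 0)
  | n'.+1 => (fix go k := match k with
      | 0 => (0, t * w 0%N n)
      | k'.+1 => let I := (incHV s t w k n').1 in let J := (go k').2 in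
         (w k n + Num.max 0 (I - J), w k n + Num.max 0 (J - I))
      end) k
  end.

Definition incH s t w k n := (incHV s t w k n).1.
Definition incV s t w k n := (incHV s t w k n).2.

Lemma incHS s t w k n : incH s t w k.+1 n.+1 =
  w k.+1 n.+1 + Num.max 0 (incH s t w k.+1 n - incV s t w k n.+1).
Proof. by []. Qed.

Lemma incVS s t w k n : incV s t w k.+1 n.+1 =
  w k.+1 n.+1 + Num.max 0 (incV s t w k n.+1 - incH s t w k.+1 n).
Proof. by []. Qed.

Arguments incHV : simpl never.

Lemma lpp_inc s t w n m :
  (lpp (bdw s t w) n m.+1 = lpp (bdw s t w) n m + incH s t w m.+1 n) /\
  (lpp (bdw s t w) n.+1 m = lpp (bdw s t w) n m + incV s t w m n.+1).
Proof.
have H0 k : lpp (bdw s t w) 0 k.+1 = lpp (bdw s t w) 0 k + incH s t w k.+1 0.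
  by rewrite lppS0.
have V0 k : lpp (bdw s t w) k.+1 0 = lpp (bdw s t w) k 0 + incV s t w 0 k.+1.
  by rewrite lpp0S.
(* One cell at a time: increments are taken from the lower left corner of the cell, so the maximum
   in the recursion becomes the positive part of a difference. *)
suff step n' m' :
    lpp (bdw s t w) n' m'.+1 = lpp (bdw s t w) n' m' + incH s t w m'.+1 n' ->
    lpp (bdw s t w) n'.+1 m' = lpp (bdw s t w) n' m' + incV s t w m' n'.+1 ->
    lpp (bdw s t w) n'.+1 m'.+1 = lpp (bdw s t w) n'.+1 m' + incH s t w m'.+1 n'.+1 /\
    lpp (bdw s t w) n'.+1 m'.+1 = lpp (bdw s t w) n' m'.+1 + incV s t w m'.+1 n'.+1.
  elim: n m => [m|n IHn m].
    split; first exact: H0.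
    elim: m => [|m IHm]; first exact: V0.
    by have [] := step 0%N m (H0 _) IHm.
  have HH : forall k, lpp (bdw s t w) n.+1 k.+1 = lpp (bdw s t w) n.+1 k + incH s t w k.+1 n.+1.
    move=> k; have [h1 h2] := IHn k.
    by have [] := step _ _ h1 h2.
  split; first exact: HH.
  elim: m => [|m IHm]; first exact: V0.
  by have [] := step n.+1 m (HH _) IHm.
move=> h1 h2; rewrite lppSS incHS incVS h1 h2 /=.
set L := lpp _ _ _; set I := incH _ _ _ _ _; set J := incV _ _ _ _ _.
have [IJ|JI] := leP I J.
- rewrite max_l ?lerD2l// [in X in X /\ _]max_l ?[in X in _ /\ X]max_r; lra.
- rewrite max_r ?lerD2l ?(ltW JI)// [in X in X /\ _]max_r ?[in X in _ /\ X]max_l; lra.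
Qed.

(** Increments are summed up the vertical axis and then along row [n]; under the Burke property each
    of the two sums has independent terms of known law. *)
Lemma lpp_bdwE s t w n m : lpp (bdw s t w) n m =
  \sum_(j < n) (t * w 0%N j.+1) + \sum_(i < m) incH s t w i.+1 n.
Proof.
elim: m => [|m IH]; last by rewrite (lpp_inc s t w n m).1 IH big_ord_recr addrA.
rewrite big_ord0 addr0; elim: n => [|n IHn]; first by rewrite big_ord0 lpp00.
by rewrite lpp0S IHn big_ord_recr.
Qed.

End lpp.

(** * Exponential laws and the Burke property of a cell *)

Definition image_law {d d'} {T : measurableType d} {T' : measurableType d'}
    {R : realType} (P : probability T R) {f : T -> T'}
    (mf : measurable_fun setT f) : probability T' R :=
  let mff := isMeasurableFun.Build _ _ _ _ f mf in
  let F : {mfun T >-> T'} := HB.pack f mff in distribution P F.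

Definition image_measure {d d'} {T : measurableType d} {T' : measurableType d'}
    {R : realType} (m : {measure set T -> \bar R}) {f : T -> T'}
    (mf : measurable_fun setT f) : {measure set T' -> \bar R} :=
  ltac:(refine (pushforward m f : {measure set T' -> \bar R}); exact: mf).

Section exponential_law.
Context {R : realType}.
Implicit Types (c k l : R) (A B : set R).

Lemma measure_ray_unique (m1 m2 : {measure set (RT R) -> \bar R}) :
  (forall k, m1 `]k, +oo[%classic = m2 `]k, +oo[%classic) ->
  (m1 setT < +oo)%E ->
  forall A, measurable A -> m1 A = m2 A.
Proof.
move=> m12 m1oo.
apply: (@measure_unique _ R (RT R) (@measurable_realfun.RGenOInfty.G R)
  (fun n : nat => `]- n%:R, +oo[%classic)).
- exact: measurable_realfun.RGenOInfty.measurableE.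
- move=> _ _ [x ->] [y ->]; exists (Num.max x y).
  by apply/seteqP; split => z /=; rewrite !in_itv/= !andbT gt_max => /andP.
- by move=> n; exists (- n%:R).
- apply/seteqP; split => // x _; exists (Num.truncn `|x|).+1 => //=.
  rewrite in_itv/= andbT ltrNl (le_lt_trans _ (truncnS_gt _))//.
  by rewrite -normrN ler_norm.
- by move=> _ [x ->].
- by move=> k; apply: le_lt_trans m1oo; apply: le_measure => //; exact: mem_set.
Qed.

Lemma exponential_prob_lt0 l : 0 < l ->
  exponential_prob l `]-oo, 0[%classic = 0%E.
Proof.
move=> l0; apply: integral0_eq => x /=; rewrite in_itv/= => x0.
by rewrite lt0_exponential_pdf.
Qed.

Definition exp_probability {l} (l0 : 0 < l) : probability (RT R) R :=
  @exponential_distribution_exponential_prob__canonical__probability_measure_Probability R l l0.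

Lemma exponential_prob_ray l k : 0 < l ->
  exponential_prob l `]k, +oo[%classic = (expR (- l * Num.max 0 k))%:E.
Proof.
move=> l0; pose E := exp_probability l0.
have E0 : E `]-oo, 0]%classic = 0%E.
  rewrite -(@setUitv1 _ _ -oo%O 0 true)// measureU0//.
    exact: exponential_prob_lt0.
  exact: integral_set1.
have -> : exponential_prob l `]k, +oo[%classic = (1 - E `]-oo, k]%classic)%E.
  by rewrite -(probability_setC E)// setCitvl.
have [k0|k0] := leP k 0.
  rewrite mulr0 expR0 (_ : E _ = 0%E) ?sube0//.
  apply: (@subset_measure0 _ _ _ E _ `]-oo, 0]%classic) => //.
  by apply: subset_itvl; rewrite bnd_simp.
rewrite (_ : `]-oo, k]%classic = `]-oo, 0[%classic `|` `[0, k]%classic); last first.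
  by rewrite -itv_bndbnd_setU// bnd_simp ltW.
rewrite measureU//; last first.
  by apply/seteqP; split => // x /=; rewrite !in_itv/= => -[? /andP[]]; lra.
rewrite [X in (_ - (X + _))%E]exponential_prob_lt0// add0e.
rewrite [X in (_ - X)%E](exponential_prob_itv0c l k0).
by rewrite -EFinB opprB addrC subrK.
Qed.

Definition scale c (x : RT R) : RT R := c * x.

Lemma measurable_scale c : measurable_fun setT (scale c).
Proof. exact: measurable_funM. Qed.

HB.instance Definition _ c :=
  isMeasurableFun.Build _ _ _ _ (scale c) (measurable_scale c).

Definition exp1 : probability (RT R) R := exp_probability ltr01.

(* the exponential law of mean [c] (the Dirac mass at [0] when [c = 0]) *)
Definition expm c : probability (RT R) R := distribution exp1 (scale c).

Lemma expm_ray c k : 0 < c ->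
  expm c `]k, +oo[%classic = (expR (- (Num.max 0 k / c)))%:E.
Proof.
move=> c0; rewrite /expm /= /distribution /pushforward /=.
rewrite (_ : _ @^-1` _ = `]k / c, +oo[%classic); last first.
  by apply/seteqP; split => x /=; rewrite !in_itv/= !andbT /scale ltr_pdivrMr// [x * c]mulrC.
rewrite exponential_prob_ray// mulN1r.
by rewrite maxr_pMl ?invr_ge0 ?ltW// mul0r.
Qed.

Lemma exponential_probE l A : 0 < l -> measurable A ->
  exponential_prob l A = expm l^-1 A.
Proof.
move=> l0 mA; apply: (measure_ray_unique (exp_probability l0)) => //.
  move=> k; rewrite [RHS]expm_ray ?invr_gt0// invrK.
  by rewrite [LHS]exponential_prob_ray// mulrC mulrN.
exact: (le_lt_trans (probability_le1 (exp_probability l0) measurableT) (ltry 1)).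
Qed.

Lemma expm1 A : expm 1 A = exp1 A.
Proof.
rewrite /expm /= /distribution /pushforward /=; congr exponential_prob.
by apply/seteqP; split => x; rewrite /preimage/= /scale mul1r.
Qed.

Definition translate k (x : RT R) : RT R := x + k.

Lemma measurable_translate k : measurable_fun setT (translate k).
Proof. exact: measurable_funD. Qed.

HB.instance Definition _ k :=
  isMeasurableFun.Build _ _ _ _ (translate k) (measurable_translate k).

Lemma expm_memoryless c k A : 0 < c -> 0 <= k -> measurable A ->
  expm c (A `&` `]k, +oo[%classic) =
  ((expR (- (k / c)))%:E * expm c (translate k @^-1` A))%E.
Proof.
move=> c0 k0 mA.
have mk : measurable (`]k, +oo[%classic : set (RT R)) by [].
pose m2 : {measure set (RT R) -> \bar R} :=
  mscale (NngNum (expR_ge0 (- (k / c)))) (distribution (expm c) (translate k)).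
suff : mrestr (expm c) mk A = m2 A by [].
apply: measure_ray_unique => //.
- move=> x; rewrite /m2 /mscale /= /mrestr /distribution /pushforward.
  rewrite (_ : _ `&` _ = `]Num.max x k, +oo[%classic); last first.
    by apply/seteqP; split => z /=; rewrite !in_itv/= !andbT gt_max => /andP.
  rewrite [X in _ = (_ * expm c X)%E](_ : _ = `]x - k, +oo[%classic); last first.
    by apply/seteqP; split => z /=; rewrite !in_itv/= !andbT /translate ltrBlDr.
  rewrite [LHS]expm_ray// expm_ray// -EFinM -expRD; congr (expR _)%:E.
  rewrite -opprD -mulrDl; congr (- (_ / _)).
  have [xk|xk] := leP x k.
    by rewrite max_r// max_l ?addr0// subr_le0.
  rewrite max_r ?max_r; lra.
- apply: le_lt_trans (ltry 1); apply: (probability_le1 (expm c)).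
  exact: measurableI.
Qed.

Definition diffR (z : RT R * RT R) : RT R := z.1 - z.2.

Lemma measurable_diffR : measurable_fun setT diffR.
Proof. exact: measurable_funB. Qed.

HB.instance Definition _ :=
  isMeasurableFun.Build _ _ _ _ diffR measurable_diffR.

Local Notation expm2 s t := (expm s \x expm t)%E.

(** Memorylessness of an independent pair. It holds for rectangles by the one-dimensional case, and
    uniqueness of the product measure extends it to all measurable [C]. *)
Lemma expm2_shift (s t k : R) (C : set (RT R * RT R)) : 0 < s -> 0 < t -> 0 <= k ->
  measurable C ->
  expm2 s t (C `&` (`]k, +oo[%classic `*` `]k, +oo[%classic)) =
  ((expR (- (k / s + k / t)))%:E *
   expm2 s t [set z | C (z.1 + k, z.2 + k)%R])%E.
Proof.
move=> s0 t0 k0 mC.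
have mk : measurable (`]k, +oo[%classic : set (RT R)) by [].
have mkk : measurable (`]k, +oo[%classic `*` `]k, +oo[%classic : set (RT R * RT R)).
  exact: measurableX.
pose sh (z : RT R * RT R) : RT R * RT R := (translate k z.1, translate k z.2).
have msh : measurable_fun setT sh.
  by apply: measurable_fun_pair; apply: measurableT_comp.
pose m1 := image_law (expm s) (measurable_translate k).
pose m2 := image_law (expm t) (measurable_translate k).
have e0 : (0 <= expR (k / s + k / t)) by exact: expR_ge0.
pose m' : {measure set (RT R * RT R) -> \bar R} :=
  mscale (NngNum e0) (mrestr (expm2 s t) mkk).
have m'E X : m' X = ((expR (k / s + k / t))%:E *
    expm2 s t (X `&` (`]k, +oo[%classic `*` `]k, +oo[%classic)))%E by [].
have m2E X : image_law (expm2 s t) msh X = expm2 s t (sh @^-1` X) by [].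
have E1 : (m1 \x m2)%E C = m' C.
  apply: product_measure_unique => // A B mA mB.
  rewrite m'E -setXI [X in (_ * X)%E]product_measure1E//; [|exact: measurableI..].
  rewrite [X in (_ * (X * _))%E](expm_memoryless _ _ _ s0 k0 mA).
  rewrite [X in (_ * (_ * X))%E](expm_memoryless _ _ _ t0 k0 mB).
  rewrite [X in (_ * X)%E]muleACA [LHS]muleA -!EFinM -!expRD.
  rewrite (_ : expR _ = 1); first by rewrite mul1e.
  by rewrite -[RHS]expR0; congr expR; ring.
have E2 : (m1 \x m2)%E C = image_law (expm2 s t) msh C.
  apply: product_measure_unique => // A B mA mB.
  rewrite [LHS]m2E (_ : _ @^-1` _ = (translate k @^-1` A) `*` (translate k @^-1` B))//.
  by rewrite [LHS]product_measure1E//; rewrite -[X in measurable X]setTI; apply: measurable_translate.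
rewrite m2E m'E in E2 E1.
have ee : expR (- (k / s + k / t)) * expR (k / s + k / t) = 1.
  by rewrite mulrC expRxMexpNx_1.
transitivity ((expR (- (k / s + k / t)))%:E * ((expR (k / s + k / t))%:E *
    expm2 s t (C `&` (`]k, +oo[%classic `*` `]k, +oo[%classic))))%E.
  by rewrite [RHS]muleA -EFinM ee mul1e.
congr (_ * _)%E.
exact: (etrans (esym E1) E2).
Qed.

Definition minR (z : RT R * RT R) : RT R := Num.min z.1 z.2.

Lemma measurable_minR : measurable_fun setT minR.
Proof. exact: measurable_minr. Qed.

(** The event that the minimum exceeds [k] is a quadrant, and shifting it back along the diagonal
    preserves the difference; memorylessness thus factors out the tail of the minimum, of rate
    [1/s + 1/t = 1]. *)
Lemma expm2_min_diff (s t : R) (A B : set (RT R)) : 0 < s -> 0 < t ->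
  s^-1 + t^-1 = 1 -> measurable A -> measurable B ->
  expm2 s t (minR @^-1` A `&` diffR @^-1` B) =
  (expm 1 A * expm2 s t (diffR @^-1` B))%E.
Proof.
move=> s0 t0 st mA mB.
have mDB : measurable (diffR @^-1` B).
  by rewrite -[X in measurable X]setTI; exact: measurable_diffR.
pose m1 : {measure set (RT R) -> \bar R} :=
  image_measure (mrestr (expm2 s t) mDB) measurable_minR.
have c0 : 0 <= fine (expm2 s t (diffR @^-1` B)) by exact: fine_ge0.
pose m2 : {measure set (RT R) -> \bar R} := mscale (NngNum c0) (expm 1).
have m1E X : m1 X = expm2 s t (minR @^-1` X `&` diffR @^-1` B) by [].
have m2E X : m2 X = (expm 1 X * expm2 s t (diffR @^-1` B))%E.
  rewrite muleC -[X in (X * _)%E]fineK//.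
  rewrite ge0_fin_numE//.
  exact: le_lt_trans (probability_le1 (expm2 s t) mDB) (ltry 1).
rewrite -m1E -m2E; apply: measure_ray_unique => //.
  move=> k; rewrite m1E m2E.
  have [k0|k0] := leP 0 k.
    rewrite (_ : _ `&` _ =
      diffR @^-1` B `&` (`]k, +oo[%classic `*` `]k, +oo[%classic)); last first.
      rewrite setIC; congr (_ `&` _); apply/seteqP; split => -[x y].
        by rewrite /minR /= !in_itv/= !andbT lt_min => /andP.
      by rewrite /minR /= !in_itv/= !andbT lt_min => -[-> ->].
    apply: (etrans (expm2_shift _ _ _ _ s0 t0 k0 mDB)).
    rewrite [X in _ = (X * _)%E](expm_ray _ k ltr01) divr1 (max_r k0) -mulrDr st mulr1.
    congr (_ * _)%E.
    congr (expm2 s t _); apply/seteqP; split => -[x y];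
      by rewrite /diffR /= opprD addrACA subrr addr0.
  (* For [k < 0] the ray has full mass, which follows from the case [k = 0] by monotonicity. *)
  rewrite [X in _ = (X * _)%E](expm_ray _ k ltr01) (max_l (ltW k0)) mul0r oppr0 expR0 mul1e.
  apply/eqP; rewrite eq_le; apply/andP; split.
    by apply: le_measure => //; apply: mem_set => //; apply: measurableI => //;
      rewrite -[X in measurable X]setTI; exact: measurable_minR.
  have := expm2_shift _ _ _ _ s0 t0 (lexx 0) mDB.
  rewrite !mul0r addr0 oppr0 expR0 mul1e.
  rewrite (_ : [set z | _] = diffR @^-1` B); last first.
    by apply/seteqP; split => -[x y]; rewrite /= !addr0.
  move=> <-; apply: le_measure.
  - by apply: mem_set; apply: measurableI => //; exact: measurableX.
  - by apply: mem_set; apply: measurableI => //;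
      rewrite -[X in measurable X]setTI; exact: measurable_minR.
  - move=> [x y] [Dxy] /=; rewrite !in_itv/= !andbT => -[x0 y0]; split; last exact: Dxy.
    by rewrite /minR lt_min !(lt_trans k0).
apply: (le_lt_trans _ (ltry 1)).
rewrite m1E; apply: (probability_le1 (expm2 s t)).
by apply: measurableI => //; rewrite -[X in measurable X]setTI; exact: measurable_minR.
Qed.

(* The cell of the stationary model: incoming increments [z.2.1] (horizontal) and
   [z.2.2] (vertical), weight [z.1]; by [expm2_min_diff] the minimum of the
   increments is independent of their difference and distributed as the weight. *)
Lemma burke_cell (s t : R) (B1 B2 B3 : set (RT R)) : 0 < s -> 0 < t ->
  s^-1 + t^-1 = 1 -> measurable B1 -> measurable B2 -> measurable B3 ->
  (expm 1 \x expm2 s t)%E [set z : RT R * (RT R * RT R) |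
     [/\ B1 (z.1 + Num.max 0 (z.2.1 - z.2.2)),
         B2 (z.1 + Num.max 0 (z.2.2 - z.2.1)) & B3 (Num.min z.2.1 z.2.2)]]
  = (expm s B1 * expm t B2 * expm 1 B3)%E.
Proof.
move=> s0 t0 st mB1 mB2 mB3.
pose f (z : RT R * RT R) : RT R * RT R :=
  (z.1 + Num.max 0 z.2, z.1 + Num.max 0 (- z.2)).
have mf : measurable_fun setT f.
  apply: measurable_fun_pair; apply: measurable_funD => //.
  - exact: measurable_maxr.
  - by apply: measurable_maxr => //; exact: measurableT_comp.
pose H := f @^-1` (B1 `*` B2).
have mH : measurable H.
  by rewrite /H -[X in measurable X]setTI; apply: mf => //; exact: measurableX.
pose nuD := image_law (expm2 s t) measurable_diffR.
have mKD : measurable_fun setT (fun z => (minR z, diffR z)).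
  by apply: measurable_fun_pair; [exact: measurable_minR|exact: measurable_diffR].
have lawKD X : measurable X ->
    (expm 1 \x nuD)%E X = image_law (expm2 s t) mKD X.
  move=> mX; apply: product_measure_unique => // A B mA mB.
  exact: expm2_min_diff.
(* The outgoing pair is [f] of the weight and the difference, both independent of the minimum.
   Replacing the weight by the minimum, which has the same law and is also independent of the
   difference, [f] returns the incoming pair. *)
transitivity ((expm 1 \x nuD)%E H * expm 1 B3)%E; last first.
  rewrite lawKD// [X in (X * _)%E](_ : _ = expm2 s t (B1 `*` B2)).
    by rewrite product_measure1E.
  rewrite /image_law /= /distribution /pushforward /=.
  have mD (x y : R) : Num.min x y + Num.max 0 (x - y) = x.
    by have [xy|xy] := leP x y; [rewrite max_l|rewrite max_r]; lra.
  congr (expm2 s t _); apply/seteqP; split => -[x y];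
    by rewrite /H /f /= /minR /diffR /= opprB mD minC mD.
transitivity (\int[expm 1]_x (nuD (xsection H x) * expm 1 B3))%E; last first.
  rewrite ge0_integralZr//; exact: measurable_fun_xsection.
apply: eq_integral => x _.
have mHx : measurable (xsection H x) by exact: measurable_xsection.
transitivity (expm2 s t (minR @^-1` B3 `&` diffR @^-1` (xsection H x))); last first.
  by rewrite expm2_min_diff// muleC.
congr (expm2 s t _); apply/seteqP; split => z.
  move=> /set_mem[b1 b2 b3]; split; first exact: b3.
  by apply/mem_set; rewrite /H /f /= /diffR /= opprB.
move=> [b3 /set_mem]; rewrite /H /f /= /diffR /= opprB => -[b1 b2].
exact/mem_set.
Qed.

End exponential_law.

(** * First and second moments of exponential laws *)

Section moments.
Context {R : realType}.
Implicit Types (c k l : R) (A B : set R).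

Lemma ge0_integral_law {d d'} {T : measurableType d} {T' : measurableType d'}
    (P : probability T R) (nu : probability T' R) (X : T -> T') (f : T' -> \bar R) :
  measurable_fun setT X -> (forall B : set T', measurable B -> P (X @^-1` B) = nu B) ->
  measurable_fun setT f -> (forall x, (0 <= f x)%E) ->
  (\int[P]_w f (X w) = \int[nu]_x f x)%E.
Proof.
move=> mX lawX mf f0.
rewrite [RHS](eq_measure_integral (image_measure P mX)); last first.
  by move=> A mA _; rewrite -[LHS]lawX.
by rewrite [RHS](ge0_integral_pushforward mX).
Qed.

Lemma measurable_max0 : measurable_fun setT (fun x : RT R => (Num.max 0 x : R)%:E).
Proof. by apply/measurable_EFinP; exact: measurable_maxr. Qed.

Lemma max0_ge0 (x : R) : (0 <= (Num.max 0 x)%:E)%E.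
Proof. by rewrite lee_fin le_max lexx. Qed.

Lemma integral_exp1 : (\int[exp1]_x (Num.max 0 x : R)%:E = 1)%E.
Proof.
pose f (x : RT R) : R := Num.max 0 x.
have mf : measurable_fun setT f by exact: measurable_maxr.
pose mff := isMeasurableFun.Build _ _ _ _ f mf.
pose X : {RV (@exp1 R) >-> R} := HB.pack f mff.
have X0 x : 0 <= X x by rewrite /X /= le_max lexx.
have := ge0_expectation_ccdf X0; rewrite unlock => /= ->.
(* The mean is the integral of the tail [exp (- x)], which is also the density, so it equals the
   total mass. *)
transitivity (exponential_prob (1 : R) `[0, +oo[%classic); last first.
  have := probability_setC (@exp1 R) (measurable_itv `]-oo, 0[).
  rewrite [X in (1 - X)%E]exponential_prob_lt0// sube0 => <-.
  by rewrite setCitvl.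
apply: eq_integral => x /set_mem; rewrite /= in_itv/= andbT => x0.
rewrite exponential_pdfE// mul1r /ccdf /distribution /pushforward.
rewrite (_ : _ @^-1` _ = `]x, +oo[%classic); last first.
  apply/seteqP; split => z /=; rewrite !in_itv/= !andbT lt_max (ltNge x 0) x0//.
by rewrite [LHS]exponential_prob_ray// max_r.
Qed.

Lemma integral_expm c : 0 <= c ->
  (\int[expm c]_x (Num.max 0 x : R)%:E = c%:E)%E.
Proof.
move=> c0.
rewrite -(ge0_integral_law exp1 (expm c) (scale c) _ (measurable_scale c) _ measurable_max0 max0_ge0)//.
transitivity (\int[exp1]_x (c%:E * (Num.max 0 x : R)%:E))%E.
  by apply: eq_integral => x _; rewrite /scale -EFinM maxr_pMr// mulr0.
rewrite ge0_integralZl//.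
- by rewrite integral_exp1 mule1.
- exact: measurable_max0.
- by move=> x _; exact: max0_ge0.
Qed.

Lemma integral_expm2_mul (s t : R) : 0 <= s -> 0 <= t ->
  (\int[expm s \x expm t]_z (Num.max 0 z.1 * Num.max 0 z.2 : R)%:E = (s * t)%:E)%E.
Proof.
move=> s0 t0.
have mp1 : measurable_fun setT (fun z : RT R * RT R => Num.max 0 z.1 : R).
  exact: measurable_maxr.
have mp2 : measurable_fun setT (fun z : RT R * RT R => Num.max 0 z.2 : R).
  exact: measurable_maxr.
rewrite (fubini_tonelli1 (fun z : RT R * RT R => (Num.max 0 z.1 * Num.max 0 z.2 : R)%:E)); last 2 first.
  by apply/measurable_EFinP; exact: measurable_funM.
  by move=> z; rewrite lee_fin mulr_ge0// le_max lexx.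
rewrite /fubini_F /=.
rewrite (eq_integral (fun x : RT R => t%:E * (Num.max 0 x : R)%:E)%E); last first.
  move=> x _; under eq_integral do rewrite EFinM.
  rewrite ge0_integralZl//.
  - by rewrite integral_expm// muleC.
  - exact: measurable_max0.
  - by move=> y _; exact: max0_ge0.
  - exact: max0_ge0.
rewrite ge0_integralZl//.
- by rewrite integral_expm// mulrC EFinM.
- exact: measurable_max0.
- by move=> x _; exact: max0_ge0.
Qed.

(* [K = min I J] for independent [I], [J] of mean 2, hence [K ^ 2 <= I * J]. *)
Lemma integral_exp1_sqr :
  (\int[exp1]_x ((Num.max 0 x : R) ^+ 2)%:E <= 4%:E)%E.
Proof.
have h2 : 2^-1 + 2^-1 = 1 :> R by lra.
have msq : measurable_fun setT (fun x : RT R => ((Num.max 0 x : R) ^+ 2)%:E).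
  by apply/measurable_EFinP; apply: measurable_funX; exact: measurable_maxr.
have law B : measurable B -> (expm 2 \x expm 2)%E (minR @^-1` B) = @exp1 R B.
  move=> mB; have := expm2_min_diff 2 2 B setT (ltr0Sn _ _) (ltr0Sn _ _) h2 mB measurableT.
  by rewrite preimage_setT setIT (probability_setT (expm 2 \x expm 2)%E) mule1 expm1.
rewrite -(ge0_integral_law (expm 2 \x expm 2)%E exp1 minR _ measurable_minR law msq); last first.
  by move=> x; rewrite lee_fin sqr_ge0.
have mp1 : measurable_fun setT (fun z : RT R * RT R => Num.max 0 z.1 : R).
  exact: measurable_maxr.
have mp2 : measurable_fun setT (fun z : RT R * RT R => Num.max 0 z.2 : R).
  exact: measurable_maxr.
apply: (@le_trans _ _ (\int[expm 2 \x expm 2]_z (Num.max 0 z.1 * Num.max 0 z.2 : R)%:E)%E).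
  apply: ge0_le_integral => //.
  - by move=> z _; rewrite lee_fin sqr_ge0.
  - by apply: (measurableT_comp msq); exact: measurable_minR.
  - by apply/measurable_EFinP; exact: measurable_funM.
  - move=> [x y] _; rewrite lee_fin /minR /= expr2.
    by apply: ler_pM; rewrite ?le_max2 ?ge_min ?lexx ?orbT// le_max lexx.
by rewrite integral_expm2_mul// lee_fin; lra.
Qed.

Lemma integral_expm_sqr c : 0 <= c ->
  (\int[expm c]_x ((Num.max 0 x : R) ^+ 2)%:E <= (4 * c ^+ 2)%:E)%E.
Proof.
move=> c0.
have msq : measurable_fun setT (fun x : RT R => ((Num.max 0 x : R) ^+ 2)%:E).
  by apply/measurable_EFinP; apply: measurable_funX; exact: measurable_maxr.
have sq0 (x : RT R) : (0 <= ((Num.max 0 x : R) ^+ 2)%:E)%E by rewrite lee_fin sqr_ge0.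
rewrite -(ge0_integral_law exp1 (expm c) (scale c) _ (measurable_scale c) _ msq sq0)//.
rewrite (eq_integral (fun x : RT R => (c ^+ 2)%:E * ((Num.max 0 x : R) ^+ 2)%:E)%E); last first.
  by move=> x _; rewrite /scale -EFinM -exprMn maxr_pMr// mulr0.
rewrite ge0_integralZl//; last by rewrite lee_fin sqr_ge0.
rewrite [4 * _]mulrC [leRHS]EFinM; apply: lee_pmul => //; last exact: integral_exp1_sqr.
- by rewrite lee_fin sqr_ge0.
- by apply: integral_ge0 => x _; exact: sq0.
Qed.

End moments.

(** * Independence and stationarity *)

(** The factor [k] covers joint laws restricted to an independent event of probability [k]. *)
Lemma product_measure_scale_unique {d1 d2} {T1 : measurableType d1}
    {T2 : measurableType d2} {R : realType} (m1 : probability T1 R)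
    (m2 : probability T2 R) (m : {measure set (T1 * T2) -> \bar R}) (k : R) :
  0 <= k ->
  (forall A B, measurable A -> measurable B ->
    m (A `*` B) = (k%:E * (m1 A * m2 B))%E) ->
  forall X, measurable X -> m X = (k%:E * (m1 \x m2) X)%E.
Proof.
move=> k0 mE.
pose m' : {measure set (T1 * T2) -> \bar R} := mscale (NngNum k0) (m1 \x m2)%E.
suff H X : measurable X -> m X = m' X by [].
pose C : set (set (T1 * T2)) :=
  [set C | exists A, measurable A /\ exists B, measurable B /\ C = A `*` B].
apply: (@measure_unique _ R _ C (fun=> setT)).
- rewrite measurable_prod_measurableType //; congr (<<s _ >>).
  rewrite predeqE; split => [[A mA [B mB <-]]|[A [mA [B [mB ->]]]]].
    by exists A; split => //; exists B.
  by exists A => //; exists B.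
- move=> /= _ _ [X1 [mX1 [X2 [mX2 ->]]]] [Y1 [mY1 [Y2 [mY2 ->]]]].
  rewrite -setXI; exists (X1 `&` Y1); split; first exact: measurableI.
  by exists (X2 `&` Y2); split => //; exact: measurableI.
- move=> n; exists setT; split => //; exists setT; split => //.
  by rewrite setXTT.
- by rewrite bigcup_const//; exists 0%N.
- move=> _ [A [mA [B [mB ->]]]]; rewrite mE//.
  by rewrite /m' -[X in (_ * X)%E](product_measure1E m1 m2).
- move=> n; rewrite -setXTT mE// (probability_setT m1) (probability_setT m2).
  by rewrite !mule1 ltry.
Qed.

Section joint_law.
Context {d} {T : measurableType d} {R : realType} (P : probability T R).
Context {I : eqType}.
Implicit Types (V : I -> T -> R) (nu : I -> probability (RT R) R).

Definition box V (s : seq I) (B : I -> set R) :=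
  [set w | forall i, i \in s -> B i (V i w)].

(** Independence and marginal laws in one statement, indexed by duplicate-free lists so that a
    coordinate can be split off with [box_cons]. *)
Definition joint_law V nu := forall (s : seq I) (B : I -> set R), uniq s ->
  (forall i, measurable (B i)) -> P (box V s B) = (\prod_(i <- s) nu i (B i))%E.

Lemma box_nil V B : box V [::] B = setT.
Proof. by apply/seteqP; split. Qed.

Lemma box_cons V i s B : box V (i :: s) B = V i @^-1` B i `&` box V s B.
Proof.
apply/seteqP; split => w /=.
  by move=> H; split => [|j js]; apply: H; rewrite inE ?eqxx// js orbT.
by move=> [Hi H] j; rewrite inE => /predU1P[->|/H].
Qed.

Lemma measurable_box V s B : (forall i, i \in s -> measurable_fun setT (V i)) ->
  (forall i, measurable (B i)) -> measurable (box V s B).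
Proof.
move=> mV mB; elim: s mV => [|i s IH] mV; first by rewrite box_nil.
rewrite box_cons; apply: measurableI.
  by rewrite -[X in measurable X]setTI; apply: mV; rewrite ?inE ?eqxx.
by apply: IH => j js; apply: mV; rewrite inE js orbT.
Qed.

Lemma joint_law_marginal V nu i B : joint_law V nu -> measurable B ->
  P (V i @^-1` B) = nu i B.
Proof.
move=> Vnu mB; have := Vnu [:: i] (fun=> B) isT (fun=> mB).
by rewrite box_cons box_nil setIT big_seq1.
Qed.

Lemma joint_law_pair V nu i j (A B : set R) : joint_law V nu -> i != j ->
  measurable A -> measurable B ->
  P (V i @^-1` A `&` V j @^-1` B) = (nu i A * nu j B)%E.
Proof.
move=> Vnu ij mA mB.
have := Vnu [:: i; j] (fun k => if k == i then A else B).
rewrite !box_cons box_nil setIT !big_cons big_nil mule1 eqxx.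
rewrite (eq_sym j i) (negbTE ij); apply.
  by rewrite /= inE ij.
by move=> k; case: ifP.
Qed.

Lemma eq_joint_law V V' nu : (forall i w, V i w = V' i w) ->
  joint_law V nu -> joint_law V' nu.
Proof.
by move=> VV'; rewrite (_ : V = V')//; apply/funext => i; apply/funext => w.
Qed.

(** Coordinates of [t] that do not occur in a given list are added to it with the trivial condition
    [setT]. *)
Lemma joint_law_sup V nu (t : seq I) : uniq t ->
  (forall r B, uniq (t ++ r) -> (forall i, measurable (B i)) ->
     P (box V (t ++ r) B) = (\prod_(i <- t ++ r) nu i (B i))%E) ->
  joint_law V nu.
Proof.
move=> ut H s B us mB.
pose r := [seq i <- s | i \notin t].
have utr : uniq (t ++ r).
  rewrite cat_uniq ut filter_uniq// andbT /=; apply/hasPn => i.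
  by rewrite mem_filter => /andP[].
pose B' i := if i \in s then B i else setT.
have mB' i : measurable (B' i) by rewrite /B'; case: ifP.
have := H r B' utr mB'.
have -> : box V (t ++ r) B' = box V s B.
  apply/seteqP; split => w /= Hw i.
    move=> si; have := Hw i; rewrite /B' si; apply.
    by rewrite mem_cat mem_filter si andbT orbN.
  by move=> _; rewrite /B'; case: ifPn => // si; exact: Hw.
move=> ->; rewrite (bigID (mem s))/= [X in (_ * X)%E]big1 ?mule1; last first.
  by move=> i; rewrite /B' => /negbTE ->; rewrite probability_setT.
rewrite -big_filter (perm_big s); last first.
  apply: uniq_perm => //; first exact: filter_uniq.
  move=> i; rewrite mem_filter mem_cat mem_filter.
  by case: (i \in s) => //=; rewrite andbT orbN.
by apply: eq_big_seq => i si; rewrite /B' si.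
Qed.

(** Indices [a] and [b] carry the horizontal and vertical increments entering a cell, [c] its
    weight; they are replaced in place by the outgoing increments and the minimum of the incoming
    ones. *)
Definition cell V (a b c : I) : I -> T -> R := fun i w =>
  if i == a then V c w + Num.max 0 (V a w - V b w) else
  if i == b then V c w + Num.max 0 (V b w - V a w) else
  if i == c then Num.min (V a w) (V b w) else V i w.

Lemma joint_law_cell V nu (a b c : I) (s t : R) : uniq [:: a; b; c] ->
  0 < s -> 0 < t -> s^-1 + t^-1 = 1 ->
  nu a = expm s -> nu b = expm t -> nu c = expm 1 ->
  (forall i, measurable_fun setT (V i)) ->
  joint_law V nu -> joint_law (cell V a b c) nu.
Proof.
move=> uabc s0 t0 st nua nub nuc mV Vnu.
apply: (joint_law_sup _ _ _ uabc) => r B; rewrite cat_uniq => /and3P[_ Nr ur] mB.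
have [ab ac bc] : [/\ a != b, a != c & b != c].
  by move: uabc; rewrite /= !inE negb_or andbT => /andP[/andP[]].
have Nrabc : {in r, forall i, [&& i != a, i != b & i != c]}.
  move=> i ir; rewrite -!negb_or; apply: contra Nr => iabc.
  by apply/hasP; exists i => //; rewrite !inE.
have uabcr : uniq ([:: a; b; c] ++ r) by rewrite cat_uniq uabc Nr ur.
set E := box V r B.
have mE : measurable E by apply: measurable_box.
pose k := fine (P E).
have PE : P E = k%:E by rewrite fineK// fin_num_measure.
have k0 : 0 <= k by exact: fine_ge0.
pose Z w : RT R * (RT R * RT R) := (V c w, (V a w, V b w)).
have mZ : measurable_fun setT Z.
  by apply: measurable_fun_pair; [exact: mV|apply: measurable_fun_pair; exact: mV].
(* On the event [E] about the other coordinates, the triple has the product law scaled by the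
   probability of [E]; [c] is split off first, then the pair [a], [b]. *)
have PZ X : measurable X ->
    P (Z @^-1` X `&` E) = (k%:E * (expm 1 \x (expm s \x expm t)) X)%E.
  pose m := image_measure (mrestr P mE) mZ.
  move=> mX; suff : m X = (k%:E * (expm 1 \x (expm s \x expm t)) X)%E by [].
  apply: product_measure_scale_unique => // A C mA mC.
  have mF : measurable (V c @^-1` A `&` E).
    by apply: measurableI => //; rewrite -[X in measurable X]setTI; exact: mV.
  pose k' := k * fine (expm 1 A).
  have mab : measurable_fun setT (fun w => (V a w : RT R, V b w : RT R)).
    by apply: measurable_fun_pair; exact: mV.
  pose m' := image_measure (mrestr P mF) mab.
  have m'E : m (A `*` C) = m' C.
    rewrite /m /m' /image_measure /= /pushforward /mrestr.
    congr (P _); apply/seteqP; split => w /=; tauto.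
  rewrite m'E muleA -[X in (_ * X * _)%E]fineK ?fin_num_measure// -EFinM.
  apply: product_measure_scale_unique => //.
    by rewrite mulr_ge0// fine_ge0.
  move=> A1 A2 mA1 mA2.
  pose B' i := if i == a then A1 else if i == b then A2 else if i == c then A else B i.
  have mB' i : measurable (B' i).
    rewrite /B'; case: (i == a); first exact: mA1.
    case: (i == b); first exact: mA2.
    by case: (i == c); [exact: mA|exact: mB].
  have B'r : {in r, forall i, B' i = B i}.
    by move=> i /Nrabc /and3P[/negbTE ia /negbTE ib /negbTE ic]; rewrite /B' ia ib ic.
  have B'a : B' a = A1 by rewrite /B' eqxx.
  have B'b : B' b = A2 by rewrite /B' eq_sym (negbTE ab) eqxx.
  have B'c : B' c = A by rewrite /B' !(eq_sym c) (negbTE ac) (negbTE bc) eqxx.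
  have E' : box V r B' = E.
    by apply/seteqP; split => w H i ir; move: (H i ir); rewrite B'r//.
  have Pr : (\prod_(i <- r) nu i (B' i))%E = k%:E.
    by rewrite -PE (Vnu _ _ ur mB); apply: eq_big_seq => i ir; rewrite B'r//.
  have := Vnu _ B' uabcr mB'.
  rewrite cat_cons cat_cons cat_cons cat0s !box_cons !big_cons Pr E' B'a B'b B'c.
  rewrite nua nub nuc => PB.
  transitivity (P (V a @^-1` A1 `&` (V b @^-1` A2 `&` (V c @^-1` A `&` E)))).
    rewrite /m' /image_measure /= /pushforward /mrestr.
    congr (P _); apply/seteqP; split => w /=; tauto.
  rewrite PB /k' EFinM [X in _ = (_ * X * _)%E]fineK ?fin_num_measure//.
  have algebra (x y z u : \bar R) : (x * (y * (z * u)) = u * z * (x * y))%E.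
    by rewrite muleA muleC (muleC z).
  exact: algebra.
pose S := [set z : RT R * (RT R * RT R) |
     [/\ B a (z.1 + Num.max 0 (z.2.1 - z.2.2)),
         B b (z.1 + Num.max 0 (z.2.2 - z.2.1)) & B c (Num.min z.2.1 z.2.2)]].
have mS : measurable S.
  have m1 : measurable_fun setT (fun z : RT R * (RT R * RT R) => z.1 + Num.max 0 (z.2.1 - z.2.2) : R).
    apply: measurable_funD => //; apply: measurable_maxr => //.
    apply: measurable_funB; exact: measurableT_comp.
  have m2 : measurable_fun setT (fun z : RT R * (RT R * RT R) => z.1 + Num.max 0 (z.2.2 - z.2.1) : R).
    apply: measurable_funD => //; apply: measurable_maxr => //.
    apply: measurable_funB; exact: measurableT_comp.
  have m3 : measurable_fun setT (fun z : RT R * (RT R * RT R) => Num.min z.2.1 z.2.2 : R).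
    apply: measurable_minr; exact: measurableT_comp.
  have -> : S = ((fun z : RT R * (RT R * RT R) => z.1 + Num.max 0 (z.2.1 - z.2.2) : R) @^-1` B a `&`
    ((fun z : RT R * (RT R * RT R) => z.1 + Num.max 0 (z.2.2 - z.2.1) : R) @^-1` B b `&`
     (fun z : RT R * (RT R * RT R) => Num.min z.2.1 z.2.2 : R) @^-1` B c)).
    by apply/seteqP; split => z; [move=> [? ? ?]; split|move=> [? [? ?]]; split].
  apply: measurableI; last apply: measurableI;
    rewrite -[X in measurable X]setTI; [exact: m1|exact: m2|exact: m3].
have cr : box (cell V a b c) r B = E.
  apply/seteqP; split => w H i ir; move: (H i ir);
  by have /and3P[/negbTE ia /negbTE ib /negbTE ic] := Nrabc i ir; rewrite /cell ia ib ic.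
rewrite cat_cons cat_cons cat_cons cat0s !box_cons cr !big_cons.
transitivity (P (Z @^-1` S `&` E)).
  congr (P _); apply/seteqP; split => w;
    rewrite /cell /Z /S /= !eqxx (eq_sym b) (negbTE ab) !(eq_sym c) (negbTE ac) (negbTE bc).
    by move=> [? [? [? ?]]]; split; first split.
  by move=> [[? ? ?] ?]; do ! split.
rewrite PZ// [X in (_ * X)%E](burke_cell _ _ _ _ _ s0 t0 st (mB a) (mB b) (mB c)).
rewrite -(Vnu _ _ ur mB) PE nua nub nuc.
have algebra (x y z u : \bar R) : (u * (x * y * z) = x * (y * (z * u)))%E.
  by rewrite muleC !muleA.
exact: algebra.
Qed.

End joint_law.

Lemma joint_law_inj {d} {T : measurableType d} {R : realType} (P : probability T R)
    {I J : eqType} (V : I -> T -> R) (nu : I -> probability (RT R) R)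
    (f : J -> I) (g : I -> J) : cancel f g ->
  joint_law P V nu -> joint_law P (fun j => V (f j)) (fun j => nu (f j)).
Proof.
move=> fK lawV s B us mB.
have ufs : uniq (map f s) by rewrite map_inj_uniq//; exact: can_inj fK.
have := lawV (map f s) (fun i => B (g i)) ufs (fun i => mB (g i)).
rewrite big_map => H; transitivity (P (box V (map f s) (fun i => B (g i)))).
  congr (P _); apply/seteqP; split => w Hw.
    by move=> _ /mapP[j js ->]; rewrite fK; exact: Hw.
  by move=> j js; have := Hw (f j) (map_f f js); rewrite fK.
by rewrite H; apply: eq_bigr => j _; rewrite fK.
Qed.

(** * Variance of a sum of pairwise uncorrelated variables *)

Section sums.
Context {d} {T : measurableType d} {R : realType} (P : probability T R).

Lemma ge0_integral_sum_ord M (A : 'I_M -> T -> R) :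
  (forall i, measurable_fun setT (A i)) -> (forall i w, 0 <= A i w) ->
  (\int[P]_w (\sum_(i < M) A i w)%:E = \sum_(i < M) \int[P]_w (A i w)%:E)%E.
Proof.
move=> mA A0; under eq_integral do rewrite -sumEFin.
by rewrite ge0_integral_sum// => [i|i x _]; [exact/measurable_EFinP|rewrite lee_fin].
Qed.

Lemma integral_sum_sqr M (A : 'I_M -> T -> R) (s : R) : 0 <= s ->
  (forall i, measurable_fun setT (A i)) -> (forall i w, 0 <= A i w) ->
  (forall i, (\int[P]_w (A i w)%:E = s%:E)%E) ->
  (forall i, (\int[P]_w (A i w ^+ 2)%:E <= (4 * s ^+ 2)%:E)%E) ->
  (forall i j, i != j -> (\int[P]_w (A i w * A j w)%:E = (s * s)%:E)%E) ->
  (\int[P]_w ((\sum_(i < M) A i w - M%:R * s) ^+ 2)%:E <= (4 * M%:R * s ^+ 2)%:E)%E.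
Proof.
move=> s0 mA A0 EA EA2 EAA.
have mS : measurable_fun setT (fun w => \sum_(i < M) A i w).
  exact: measurable_sum.
have S0 w : 0 <= \sum_(i < M) A i w by rewrite sumr_ge0.
have ES : (\int[P]_w (\sum_(i < M) A i w)%:E = (M%:R * s)%:E)%E.
  rewrite ge0_integral_sum_ord// (eq_bigr (fun=> s%:E)) => [|i _]; last exact: EA.
  by rewrite sumEFin sumr_const card_ord mulr_natl.
have ES2 : (\int[P]_w ((\sum_(i < M) A i w) ^+ 2)%:E <=
    (4 * M%:R * s ^+ 2 + (M%:R * s) ^+ 2)%:E)%E.
  have -> : (\int[P]_w ((\sum_(i < M) A i w) ^+ 2)%:E =
      \sum_(i < M) \sum_(j < M) \int[P]_w (A i w * A j w)%:E)%E.
    transitivity (\int[P]_w (\sum_(i < M) \sum_(j < M) A i w * A j w)%:E)%E.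
      apply: eq_integral => w _; congr EFin.
      by rewrite expr2 mulr_suml; apply: eq_bigr => i _; rewrite mulr_sumr.
    rewrite ge0_integral_sum_ord; last 2 first.
      by move=> i; apply: measurable_sum => j; exact: measurable_funM.
      by move=> i w; rewrite sumr_ge0// => j _; rewrite mulr_ge0.
    apply: eq_bigr => i _; rewrite ge0_integral_sum_ord// => [j|j w].
      exact: measurable_funM.
    by rewrite mulr_ge0.
  apply: (@le_trans _ _ (\sum_(i < M) (4 * s ^+ 2 + M%:R * s ^+ 2)%:E)%E); last first.
    rewrite sumEFin lee_fin sumr_const card_ord -mulr_natl.
    by rewrite le_eqVlt; apply/orP; left; apply/eqP; ring.
  apply: lee_sum => i _.
  rewrite (bigD1 i)//= EFinD; apply: leeD.
    by apply: le_trans (EA2 i); under eq_integral do rewrite -expr2.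
  rewrite (eq_bigr (fun=> (s * s)%:E)) => [|j ij]; last by rewrite EAA// eq_sym.
  rewrite sumEFin lee_fin sumr_const -[leLHS]mulr_natl -expr2 ler_wpM2r ?sqr_ge0//.
  by rewrite ler_nat (leq_trans (max_card _))// card_ord.
(* The cross term of the square is negative; it is moved to the other side so that only nonnegative
   functions are integrated. *)
have key : (\int[P]_w ((\sum_(i < M) A i w - M%:R * s) ^+ 2)%:E +
    (2 * (M%:R * s))%:E * (M%:R * s)%:E <=
    (4 * M%:R * s ^+ 2)%:E + (2 * (M%:R * s))%:E * (M%:R * s)%:E)%E.
  rewrite -[in leLHS]ES -ge0_integralZl//; last 3 first.
    exact/measurable_EFinP.
    by move=> w _; rewrite lee_fin.
    by rewrite lee_fin !mulr_ge0.
  rewrite -ge0_integralD//; last 4 first.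
    by move=> w _; rewrite lee_fin sqr_ge0.
    by apply/measurable_EFinP; apply: measurable_funX; exact: measurable_funB.
    by move=> w _; rewrite mule_ge0// lee_fin ?mulr_ge0.
    by apply/measurable_EFinP; exact: measurable_funM.
  under eq_integral => w _.
    rewrite -EFinM -EFinD (_ : _ + _ = (\sum_(i < M) A i w) ^+ 2 + (M%:R * s) ^+ 2); last by ring.
    rewrite EFinD; over.
  rewrite ge0_integralD//; last 3 first.
    by move=> w _; rewrite lee_fin sqr_ge0.
    by apply/measurable_EFinP; exact: measurable_funX.
    by move=> w _; rewrite lee_fin sqr_ge0.
  rewrite integral_cst// [X in (_ * X)%E]probability_setT mule1.
  apply: (le_trans (leeD ES2 (lexx _))).
  by rewrite -EFinM -!EFinD lee_fin; lra.
by move: key; rewrite leeD2rE.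
Qed.

End sums.

(** * Stationary increments and moments of the model with boundary *)

Section burke.
Context {d} {T : measurableType d} {R : realType} (P : probability T R).
Variables (X : nat -> nat -> T -> R) (s t : R).
Hypothesis mX : forall i j, measurable_fun setT (X i j).
Hypothesis X0 : forall i j w, 0 <= X i j w.
Hypothesis lawX : joint_law P (fun p : nat * nat => X p.1 p.2) (fun=> expm 1).
Hypotheses (s0 : 0 < s) (t0 : 0 < t) (st : s^-1 + t^-1 = 1).

Let H k n w := incH s t (fun i j => X i j w) k n.
Let V k n w := incV s t (fun i j => X i j w) k n.

Lemma measurable_incHV k n : measurable_fun setT (H k n) /\ measurable_fun setT (V k n).
Proof.
elim: n k => [k|n IHn].
  by split; [exact: measurable_funM|exact: measurable_cst].
elim=> [|k IHk].
  by split; [exact: measurable_cst|exact: measurable_funM].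
have [mH _] := IHn k.+1; have [_ mV] := IHk.
split; apply: measurable_funD => //; apply: measurable_maxr => //;
  exact: measurable_funB.
Qed.

Lemma incHV_ge0 k n w : 0 <= H k n w /\ 0 <= V k n w.
Proof.
case: n => [|n].
  by split => //; rewrite /H /incH /= mulr_ge0// ltW.
case: k => [|k].
  by split => //; rewrite /V /incV /= mulr_ge0// ltW.
by split; rewrite /H /V ?incHS ?incVS addr_ge0// le_max lexx.
Qed.

Definition burke_law (p : nat * nat) : probability (RT R) R :=
  match p with
  | (0, 0) => expm 1 | (_.+1, 0) => expm s | (0, _.+1) => expm t | _ => expm 1
  end.

(* state of the increments when the cells of rows [1 .. n] and the first [k]
   cells of row [n.+1] of the strip of width [M] have been processed; processed
   bulk vertices hold the minimum of the increments entering the cell *)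
Let state M n k (p : nat * nat) : T -> R :=
  match p with
  | (0, 0) => X 0%N 0%N
  | (i'.+1, 0) => if (i'.+1 <= M)%N && (i'.+1 <= k)%N then H i'.+1 n.+1
                  else if (i'.+1 <= M)%N then H i'.+1 n else H i'.+1 0%N
  | (0, j'.+1) => if (j'.+1 <= n)%N then V M j'.+1
                  else if j' == n then V k j'.+1 else V 0%N j'.+1
  | (i'.+1, j'.+1) =>
    if (i'.+1 <= M)%N && ((j'.+1 <= n)%N || (j' == n) && (i'.+1 <= k)%N)
    then (fun w => Num.min (H i'.+1 j' w) (V i' j'.+1 w)) else X i'.+1 j'.+1
  end.

Lemma measurable_state M n k p : measurable_fun setT (state M n k p).
Proof.
have mH i j := (measurable_incHV i j).1.
have mV i j := (measurable_incHV i j).2.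
case: p => -[|i] [|j] /=; do ?[case: ifP => _];
  first [exact: mX | exact: mH | exact: mV | exact: measurable_minr].
Qed.

(** Nothing is processed yet: up to the factors [s] and [t] on the axes, the state is the family of
    weights. *)
Lemma state0 M : joint_law P (state M 0 0) burke_law.
Proof.
move=> u B uu mB.
pose c (p : nat * nat) : R := match p with
  | (0, 0) => 1 | (_.+1, 0) => s | (0, _.+1) => t | _ => 1 end.
have c0 p : 0 < c p by case: p => -[|i] [|j] /=.
pose B' p := scale (c p) @^-1` B p.
have mB' p : measurable (B' p).
  by rewrite /B' -[X in measurable X]setTI; apply: measurable_scale => //; exact: mB.
have := lawX u B' uu mB'.
have -> : box (fun p : nat * nat => X p.1 p.2) u B' = box (state M 0 0) u B.
  apply/seteqP; split => w Hw p pu; move: (Hw p pu); rewrite /B' /scale;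
  case: p {pu} => -[|i] [|j] /=; rewrite ?mul1r ?andbF//=.
  - by case: (j == 0)%N.
  - by case: (i.+1 <= M)%N.
  - by case: (j == 0)%N.
  - by case: (i.+1 <= M)%N.
move=> ->; apply: eq_big_seq => -[[|i] [|j]] _; rewrite /B' /= ?expm1//;
  rewrite -expm1 /expm /= /distribution /pushforward /=;
  by congr exponential_prob; apply/seteqP; split => z; rewrite /preimage/= /scale ?mul1r.
Qed.

Lemma state_cell M n k p w : (k < M)%N ->
  cell (state M n k) (k.+1, 0) (0, n.+1) (k.+1, n.+1) p w = state M n k.+1 p w.
Proof.
move=> kM.
have E1 : state M n k (k.+1, 0)%N = H k.+1 n by rewrite /= ltnn andbF kM.
have E2 : state M n k (0, n.+1)%N = V k n.+1 by rewrite /= ltnn eqxx.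
have E3 : state M n k (k.+1, n.+1)%N = X k.+1 n.+1.
  by rewrite /= !ltnn eqxx/= andbF.
rewrite /cell E1 E2 E3; case: ifPn => [/eqP ->|np1].
  by rewrite /= kM leqnn /= /H incHS.
case: ifPn => [/eqP ->|np2].
  by rewrite /= ltnn eqxx /V incVS.
case: ifPn => [/eqP ->|np3].
  by rewrite /= kM leqnn eqxx orbT.
case: p np1 np2 np3 => -[|i] [|j]; rewrite !xpair_eqE ?eqSS ?andbT //=.
- move=> _ jn _; case: ifP => //; by rewrite (negbTE jn).
- by move=> ik _ _; rewrite ?ltnS (leq_eqVlt i k) (negbTE ik)/=.
- move=> _ _ ijk; congr (_ w); rewrite ?ltnS (leq_eqVlt i k).
  by case: (j == n) ijk => /=; rewrite ?andbT ?andbF// => /negbTE ->.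
Qed.

Lemma joint_law_state M n k : (k <= M)%N -> joint_law P (state M n k) burke_law.
Proof.
elim: n k => [|n IHn].
  elim=> [_|k IHk kM]; first exact: state0.
  apply: (eq_joint_law P _ _ _ (fun p w => state_cell M 0 k p w kM)).
  apply: (joint_law_cell P _ _ _ _ _ _ _ _ s0 t0) => //.
  - by rewrite /= !inE !xpair_eqE /= !andbF /= ?eqSS.
  - exact: measurable_state.
  - exact: IHk (ltnW kM).
elim=> [_|k IHk kM].
  (* Row [n.+1] with all [M] cells processed is the same state as row [n.+2] not yet started. *)
  have := IHn M (leqnn M); apply: eq_joint_law => p w; congr (_ w).
  case: p => -[|i] [|j] //=.
  - rewrite ltnS (leq_eqVlt j n); case: (j < n)%N; rewrite ?orbT ?orbF//.
    by case: (j == n) => //; case: (j == n.+1).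
  - by case: (i < M)%N.
  - rewrite ltnS (leq_eqVlt j n) andbF orbF orbC.
    by case: (i < M)%N => //=; rewrite andbT.
apply: (eq_joint_law P _ _ _ (fun p w => state_cell M n.+1 k p w kM)).
apply: (joint_law_cell P _ _ _ _ _ _ _ _ s0 t0) => //.
- by rewrite /= !inE !xpair_eqE /= !andbF /= ?eqSS.
- exact: measurable_state.
- exact: IHk (ltnW kM).
Qed.

Lemma integral_max0 (Z : T -> R) (nu : probability (RT R) R) : measurable_fun setT Z ->
  (forall w, 0 <= Z w) -> (forall B : set R, measurable B -> P (Z @^-1` B) = nu B) ->
  (\int[P]_w (Z w)%:E = \int[nu]_x (Num.max 0 x : R)%:E)%E /\
  (\int[P]_w (Z w ^+ 2)%:E = \int[nu]_x ((Num.max 0 x : R) ^+ 2)%:E)%E.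
Proof.
move=> mZ Z0 lawZ.
have msq : measurable_fun setT (fun x : RT R => ((Num.max 0 x : R) ^+ 2)%:E).
  by apply/measurable_EFinP; apply: measurable_funX; exact: measurable_maxr.
split.
  rewrite -(ge0_integral_law P nu Z _ mZ lawZ measurable_max0 max0_ge0).
  by apply: eq_integral => w _; rewrite max_r.
rewrite -(ge0_integral_law P nu Z _ mZ lawZ msq).
  by apply: eq_integral => w _; rewrite max_r.
by move=> x; rewrite lee_fin sqr_ge0.
Qed.

Lemma integral_mul_indep (Z1 Z2 : T -> R) (a b : R) : 0 <= a -> 0 <= b ->
  measurable_fun setT Z1 -> measurable_fun setT Z2 ->
  (forall w, 0 <= Z1 w) -> (forall w, 0 <= Z2 w) ->
  (forall A B : set R, measurable A -> measurable B ->
     P (Z1 @^-1` A `&` Z2 @^-1` B) = (expm a A * expm b B)%E) ->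
  (\int[P]_w (Z1 w * Z2 w)%:E = (a * b)%:E)%E.
Proof.
move=> a0 b0 mZ1 mZ2 Z10 Z20 lawZ.
have mZ : measurable_fun setT (fun w => (Z1 w : RT R, Z2 w : RT R)).
  exact: measurable_fun_pair.
rewrite -integral_expm2_mul//.
rewrite -(ge0_integral_law P (expm a \x expm b)%E (fun w => (Z1 w : RT R, Z2 w : RT R)) _ mZ).
- by apply: eq_integral => w _ /=; rewrite !max_r.
- move=> B mB; rewrite -[RHS]mul1e.
  suff : image_law P mZ B = (1%:E * (expm a \x expm b) B)%E by [].
  apply: product_measure_scale_unique => // A C mA mC.
  by rewrite mul1e; exact: lawZ.
- apply/measurable_EFinP; apply: measurable_funM; exact: measurable_maxr.
- by move=> z; rewrite lee_fin mulr_ge0// le_max lexx.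
Qed.

Lemma integral_sum_joint_law M (W : nat * nat -> T -> R) nu (f : 'I_M -> nat * nat) c :
  0 <= c -> injective f -> joint_law P W nu -> (forall i, nu (f i) = expm c) ->
  (forall p, measurable_fun setT (W p)) -> (forall i w, 0 <= W (f i) w) ->
  forall A, (forall w, A w = \sum_(i < M) W (f i) w) ->
  (\int[P]_w (A w)%:E = (M%:R * c)%:E)%E /\
  (\int[P]_w ((A w - M%:R * c) ^+ 2)%:E <= (4 * M%:R * c ^+ 2)%:E)%E.
Proof.
move=> c0 injf lawW nuf mW W0 A /funext ->.
have EW i := integral_max0 _ _ (mW (f i)) (W0 i)
  (fun B mB => joint_law_marginal P _ _ (f i) B lawW mB).
split.
  rewrite ge0_integral_sum_ord// (eq_bigr (fun=> c%:E)).
    by rewrite sumEFin sumr_const card_ord mulr_natl.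
  by move=> i _; rewrite (EW i).1 nuf integral_expm.
apply: integral_sum_sqr => //.
- by move=> i; rewrite (EW i).1 nuf integral_expm.
- by move=> i; rewrite (EW i).2 nuf integral_expm_sqr.
- move=> i j ij; apply: integral_mul_indep => // A1 A2 mA1 mA2.
  transitivity (nu (f i) A1 * nu (f j) A2)%E; last by rewrite !nuf.
  by apply: joint_law_pair => //; rewrite (inj_eq injf).
Qed.

Let G n m w := lpp (bdw s t (fun i j => X i j w)) n m.

Lemma measurable_lpp_bdw n m : measurable_fun setT (G n m).
Proof.
rewrite (_ : G n m = fun w => \sum_(j < n) (t * X 0%N j.+1 w) + \sum_(i < m) H i.+1 n w).
  apply: measurable_funD; apply: measurable_sum => i.
    exact: measurable_funM.
  exact: (measurable_incHV _ _).1.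
by apply/funext => w; rewrite /G lpp_bdwE.
Qed.

(** The vertical axis is read in the initial state and row [n] in the state of the strip of width
    [m] after [n] rows. The two sums are dependent, so the squares are combined by
    [(a + b)^2 <= 2 a^2 + 2 b^2], which turns 4 into 8. *)
Lemma integral_lpp_bdw n m :
  (\int[P]_w (G n m w)%:E = (n%:R * t + m%:R * s)%:E)%E /\
  (\int[P]_w ((G n m w - (n%:R * t + m%:R * s)) ^+ 2)%:E <=
    (8 * (n%:R * t ^+ 2 + m%:R * s ^+ 2))%:E)%E.
Proof.
pose A w := \sum_(j < n) (t * X 0%N j.+1 w).
pose B w := \sum_(i < m) H i.+1 n w.
have GE w : G n m w = A w + B w by exact: lpp_bdwE.
have [EA EA2] : (\int[P]_w (A w)%:E = (n%:R * t)%:E)%E /\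
    (\int[P]_w ((A w - n%:R * t) ^+ 2)%:E <= (4 * n%:R * t ^+ 2)%:E)%E.
  apply: (integral_sum_joint_law n (state 0 0 0) burke_law (fun j => (0%N, (j : nat).+1))
    t (ltW t0) _ (joint_law_state 0 0 0 (leqnn 0)) _ (measurable_state 0 0 0)) => //.
  - by move=> i j [] /ord_inj.
  - by move=> i w; rewrite /=; case: ifP => _; exact: (incHV_ge0 _ _ _).2.
  - by move=> w; apply: eq_bigr => j _ /=; case: ifP => _.
have [EB EB2] : (\int[P]_w (B w)%:E = (m%:R * s)%:E)%E /\
    (\int[P]_w ((B w - m%:R * s) ^+ 2)%:E <= (4 * m%:R * s ^+ 2)%:E)%E.
  apply: (integral_sum_joint_law m (state m n 0) burke_law (fun i => ((i : nat).+1, 0%N))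
    s (ltW s0) _ (joint_law_state m n 0 (leq0n m)) _ (measurable_state m n 0)) => //.
  - by move=> i j [] /ord_inj.
  - by move=> i w; rewrite /= ltn_ord andbF; exact: (incHV_ge0 _ _ _).1.
  - by move=> w; apply: eq_bigr => i _ /=; rewrite ltn_ord andbF.
have mA : measurable_fun setT A.
  by apply: measurable_sum => i; exact: measurable_funM.
have mB : measurable_fun setT B.
  by apply: measurable_sum => i; exact: (measurable_incHV _ _).1.
have A0 w : 0 <= A w by rewrite sumr_ge0// => i _; rewrite mulr_ge0// ltW.
have B0 w : 0 <= B w by rewrite sumr_ge0// => i _; exact: (incHV_ge0 _ _ _).1.
split.
  under eq_integral do rewrite GE EFinD.
  rewrite ge0_integralD//; [by rewrite EA EB EFinD|..].
  - by move=> w _; rewrite lee_fin.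
  - exact/measurable_EFinP.
  - by move=> w _; rewrite lee_fin.
  - exact/measurable_EFinP.
apply: (@le_trans _ _ (\int[P]_w (2%:E * ((A w - n%:R * t) ^+ 2)%:E +
    2%:E * ((B w - m%:R * s) ^+ 2)%:E))%E).
  apply: ge0_le_integral => //.
  - by move=> w _; rewrite lee_fin sqr_ge0.
  - apply/measurable_EFinP; apply: measurable_funX; apply: measurable_funB => //.
    exact: measurable_lpp_bdw.
  - by apply: emeasurable_funD; apply/measurable_EFinP; apply: measurable_funM => //;
      apply: measurable_funX; exact: measurable_funB.
  - move=> w _; rewrite GE -!EFinM -EFinD lee_fin.
    set a := A w - _; set b := B w - _.
    rewrite (_ : _ - _ = a + b); last by rewrite /a /b; ring.
    clearbody a b; have := sqr_ge0 (a - b); nra.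
rewrite ge0_integralD//.
- rewrite !ge0_integralZl//.
  + apply: (le_trans (leeD (lee_pmul _ _ (lexx 2%:E) EA2) (lee_pmul _ _ (lexx 2%:E) EB2))) => //.
    * by apply: integral_ge0 => w _; rewrite lee_fin sqr_ge0.
    * by apply: integral_ge0 => w _; rewrite lee_fin sqr_ge0.
    * by rewrite -!EFinM -EFinD lee_fin; lra.
  + by apply/measurable_EFinP; apply: measurable_funX; exact: measurable_funB.
  + by move=> w _; rewrite lee_fin sqr_ge0.
  + by apply/measurable_EFinP; apply: measurable_funX; exact: measurable_funB.
  + by move=> w _; rewrite lee_fin sqr_ge0.
- by move=> w _; rewrite mule_ge0// lee_fin sqr_ge0.
- by apply/measurable_EFinP; apply: measurable_funM => //; apply: measurable_funX; exact: measurable_funB.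
- by move=> w _; rewrite mule_ge0// lee_fin sqr_ge0.
- by apply/measurable_EFinP; apply: measurable_funM => //; apply: measurable_funX; exact: measurable_funB.
Qed.

End burke.

(** * Homogeneous last-passage percolation *)

Lemma measurable_lpp {d} {T : measurableType d} {R : realType}
    (w : T -> nat -> nat -> R) n m :
  (forall i j, measurable_fun setT (fun x => w x i j)) ->
  measurable_fun setT (fun x => lpp (w x) n m).
Proof.
move=> mw; move: n m; apply: lpp_ind => [|m IH|n IH|n m IH1 IH2].
- by under eq_fun do rewrite lpp00; exact: mw.
- by under eq_fun do rewrite lppS0; exact: measurable_funD.
- by under eq_fun do rewrite lpp0S; exact: measurable_funD.
- by under eq_fun do rewrite lppSS; apply: measurable_funD => //; exact: measurable_maxr.
Qed.

Section iid.
Context {d} {T : measurableType d} {R : realType} (P : probability T R).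
Variables (X : nat -> nat -> T -> R).
Hypothesis mX : forall i j, measurable_fun setT (X i j).
Hypothesis X0 : forall i j w, 0 <= X i j w.
Hypothesis lawX : joint_law P (fun p : nat * nat => X p.1 p.2) (fun=> expm 1).

Let L n m w := lpp (fun i j => X i j w) n m.
Let G s t n m w := lpp (bdw s t (fun i j => X i j w)) n m.

Let mL n m : measurable_fun setT (L n m).
Proof. exact: measurable_lpp. Qed.

Let mG s t n m : measurable_fun setT (G s t n m).
Proof.
by apply: measurable_lpp => -[|i] [|j] //=; exact: measurable_funM.
Qed.

Let G0 s t n m w : 0 <= s -> 0 <= t -> 0 <= G s t n m w.
Proof.
by move=> s0 t0; apply: lpp_ge0 => -[|i] [|j] //=; rewrite mulr_ge0.
Qed.

Lemma integral_lpp_le n m :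
  (\int[P]_w (L n m w)%:E <= (2 * (n + m)%:R + 1)%:E)%E.
Proof.
have h2 : 2^-1 + 2^-1 = 1 :> R by lra.
have [EG _] := integral_lpp_bdw P X 2 2 mX X0 lawX (ltr0Sn _ _) (ltr0Sn _ _) h2 n m.
have [EX _] := integral_max0 P _ _ (mX 0 0)%N (X0 0 0)%N
  (fun B mB => joint_law_marginal P _ _ (0, 0)%N B lawX mB).
rewrite integral_expm// in EX.
apply: (@le_trans _ _ (\int[P]_w ((G 2 2 n m w)%:E + (X 0 0 w)%:E))%E).
  apply: ge0_le_integral => //.
  - by move=> w _; rewrite lee_fin; exact: lpp_ge0.
  - exact/measurable_EFinP.
  - by apply: emeasurable_funD; exact/measurable_EFinP.
  - by move=> w _; rewrite -EFinD lee_fin; apply: lpp_le_bdw => //; lra.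
rewrite ge0_integralD//.
- rewrite EX EG -EFinD lee_fin natrD; lra.
- by move=> w _; rewrite lee_fin G0.
- exact/measurable_EFinP.
- by move=> w _; rewrite lee_fin.
- exact/measurable_EFinP.
Qed.

Lemma norm_le_sqr (x c : R) : 0 < c -> `|x| <= x ^+ 2 / (2 * c) + c / 2.
Proof.
move=> c0; rewrite -subr_ge0.
rewrite (_ : _ - _ = (`|x| - c) ^+ 2 / (2 * c)).
  by rewrite divr_ge0 ?sqr_ge0// mulr_ge0// ltW.
by rewrite -(real_normK (num_real x)); field; exact: lt0r_neq0.
Qed.

(** Controls the loss in truncating a passage time: twice the variance bound [64 n], plus twice the
    square of the mean [4 n]. *)
Lemma integral_lpp_bdw_sqr n :
  (\int[P]_w (G 2 2 n n w ^+ 2)%:E <= (128 * n%:R + 32 * n%:R ^+ 2)%:E)%E.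
Proof.
have h2 : 2^-1 + 2^-1 = 1 :> R by lra.
have [_ EG] := integral_lpp_bdw P X 2 2 mX X0 lawX (ltr0Sn _ _) (ltr0Sn _ _) h2 n n.
set c := (n%:R * 2 + n%:R * 2) in EG.
apply: (@le_trans _ _ (\int[P]_w (2%:E * ((G 2 2 n n w - c) ^+ 2)%:E + (2 * c ^+ 2)%:E))%E).
  apply: ge0_le_integral => //.
  - by move=> w _; rewrite lee_fin sqr_ge0.
  - by apply/measurable_EFinP; exact: measurable_funX.
  - apply: emeasurable_funD => //; apply/measurable_EFinP; apply: measurable_funM => //.
    by apply: measurable_funX; exact: measurable_funB.
  - move=> w _; rewrite -EFinM -EFinD lee_fin.
    by set g := G _ _ _ _ _; clearbody g c; have := sqr_ge0 (g - 2 * c); nra.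
rewrite ge0_integralD//.
- rewrite ge0_integralZl//.
  + rewrite integral_cst// [X in (_ + _ * X)%E]probability_setT mule1.
    apply: (le_trans (leeD (lee_pmul _ _ (lexx 2%:E) EG) (lexx _))) => //.
      by apply: integral_ge0 => w _; rewrite lee_fin sqr_ge0.
    by rewrite -!EFinM -EFinD lee_fin /c; lra.
  + by apply/measurable_EFinP; apply: measurable_funX; exact: measurable_funB.
  + by move=> w _; rewrite lee_fin sqr_ge0.
- by move=> w _; rewrite mule_ge0// lee_fin sqr_ge0.
- by apply/measurable_EFinP; apply: measurable_funM => //; apply: measurable_funX; exact: measurable_funB.
- by move=> w _; rewrite lee_fin mulr_ge0// sqr_ge0.
Qed.

Lemma integral_lpp_bdw_diag h n : 0 < h -> h <= 1 -> (0 < n)%N ->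
  (\int[P]_w (G (2 + h) (2 + h) n n w)%:E <=
   ((4 + 2 * h ^+ 2) * n%:R + 104 / h ^+ 2)%:E)%E.
Proof.
move=> h0 h1 n0.
have n0' : 0 < n%:R :> R by rewrite ltr0n.
(* [b] is the parameter conjugate to [a], and [a + b = 4 + h ^ 2 / (1 + h)] has no term linear in
   [h]. *)
pose a := 2 + h; pose b := (2 + h) / (1 + h).
have a0 : 0 < a by rewrite /a; lra.
have b0 : 0 < b by rewrite /b divr_gt0; lra.
have ab : a^-1 + b^-1 = 1.
  by rewrite /a /b; field; apply/andP; split; apply: lt0r_neq0; lra.
have ba : b^-1 + a^-1 = 1 by rewrite addrC.
have abE : a + b <= 4 + h ^+ 2.
  rewrite /a /b -(ler_pM2r (_ : 0 < 1 + h)); last by lra.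
  rewrite mulrDl divfK; last by apply: lt0r_neq0; lra.
  nra.
have b2 : b <= 2 by rewrite /b ler_pdivrMr; lra.
have [_ Eab] := integral_lpp_bdw P X a b mX X0 lawX a0 b0 ab n n.
have [_ Eba] := integral_lpp_bdw P X b a mX X0 lawX b0 a0 ba n n.
rewrite (addrC (_ * a)) in Eba.
set c := n%:R * b + n%:R * a in Eab Eba.
(* The scale at which absolute deviations are bounded by squares: [e] is of the order of the error
   already present in the means, and a variance of order [n] divided by [e] costs only a multiple of
   [1 / h ^ 2]. *)
pose e := h ^+ 2 * n%:R.
have e0 : 0 < e by rewrite mulr_gt0// exprn_gt0.
pose ie := (2 * e)^-1.
have ie0 : 0 <= ie by rewrite invr_ge0 mulr_ge0// ltW.
apply: (@le_trans _ _ (\int[P]_w ((ie%:E * ((G a b n n w - c) ^+ 2)%:E +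
    ie%:E * ((G b a n n w - c) ^+ 2)%:E) + (c + e)%:E))%E).
  apply: ge0_le_integral => //.
  - by move=> w _; rewrite lee_fin G0//; lra.
  - exact/measurable_EFinP.
  - apply: emeasurable_funD => //; apply: emeasurable_funD;
    apply/measurable_EFinP; apply: measurable_funM => //;
    by apply: measurable_funX; exact: measurable_funB.
  - move=> w _; rewrite -!EFinM -!EFinD lee_fin.
    apply: (le_trans (lpp_bdw_max a b _ _ _)).
    have := norm_le_sqr (G a b n n w - c) e e0.
    have := norm_le_sqr (G b a n n w - c) e e0.
    rewrite -/ie => nb na.
    have := ler_norm (G a b n n w - c); have := ler_norm (G b a n n w - c).
    have := normr_ge0 (G a b n n w - c); have := normr_ge0 (G b a n n w - c).
    rewrite ge_max -/(G a b n n w) -/(G b a n n w) => ? ? ? ?.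
    by apply/andP; split; lra.
rewrite ge0_integralD//; last 3 first.
  by move=> w _; rewrite adde_ge0// mule_ge0// lee_fin sqr_ge0.
  by apply: emeasurable_funD; apply/measurable_EFinP; apply: measurable_funM => //;
    apply: measurable_funX; exact: measurable_funB.
  by move=> w _; rewrite lee_fin addr_ge0// ?(ltW e0)// addr_ge0// mulr_ge0// ltW.
rewrite ge0_integralD//; last 4 first.
  by move=> w _; rewrite mule_ge0// lee_fin sqr_ge0.
  by apply/measurable_EFinP; apply: measurable_funM => //; apply: measurable_funX; exact: measurable_funB.
  by move=> w _; rewrite mule_ge0// lee_fin sqr_ge0.
  by apply/measurable_EFinP; apply: measurable_funM => //; apply: measurable_funX; exact: measurable_funB.
rewrite !ge0_integralZl//; last 4 first.
  by apply/measurable_EFinP; apply: measurable_funX; exact: measurable_funB.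
  by move=> w _; rewrite lee_fin sqr_ge0.
  by apply/measurable_EFinP; apply: measurable_funX; exact: measurable_funB.
  by move=> w _; rewrite lee_fin sqr_ge0.
rewrite integral_cst// [X in (_ + _ * X)%E]probability_setT mule1.
have I0 f : (0 <= \int[P]_w ((f w : R) ^+ 2)%:E)%E.
  by apply: integral_ge0 => w _; rewrite lee_fin sqr_ge0.
apply: (le_trans (leeD (leeD (lee_pmul _ _ (lexx ie%:E) Eab) (lee_pmul _ _ (lexx ie%:E) Eba)) (lexx _))) => //.
rewrite -!EFinM -!EFinD lee_fin.
have h20 : 0 < h ^+ 2 by rewrite exprn_gt0.
have ieE : ie * (8 * (n%:R * b ^+ 2 + n%:R * a ^+ 2)) = 4 * (a ^+ 2 + b ^+ 2) / h ^+ 2.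
  rewrite /ie /e; field; apply/andP; split; exact: lt0r_neq0.
have ieE' : ie * (8 * (n%:R * a ^+ 2 + n%:R * b ^+ 2)) = 4 * (a ^+ 2 + b ^+ 2) / h ^+ 2.
  by rewrite -ieE (addrC (_ * a ^+ 2)).
(* As [a <= 3] and [b <= 2]. Each of the two stationary models contributes once, whence 104. *)
have bound : 4 * (a ^+ 2 + b ^+ 2) / h ^+ 2 <= 52 / h ^+ 2.
  by rewrite ler_pM2r ?invr_gt0//; rewrite /a; nra.
have cE : c <= (4 + h ^+ 2) * n%:R by rewrite /c -mulrDr mulrC ler_wpM2r// addrC.
rewrite ieE ieE' /e; lra.
Qed.

Lemma integral_lpp_diag_ge h n : 0 < h -> h <= 1 -> (0 < n)%N ->
  (((4 - 2 * h) * n%:R - 104 / h ^+ 3)%:E <= \int[P]_w (G 1 1 n n w)%:E)%E.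
Proof.
move=> h0 h1 n0.
have h2 : 2^-1 + 2^-1 = 1 :> R by lra.
have [EG _] := integral_lpp_bdw P X 2 2 mX X0 lawX (ltr0Sn _ _) (ltr0Sn _ _) h2 n n.
have := integral_lpp_bdw_diag h n h0 h1 n0.
set I2 := (\int[P]_w _)%E => I2le.
have I20 : (0 <= I2)%E by apply: integral_ge0 => w _; rewrite lee_fin G0//; lra.
set I1 := (\int[P]_w _)%E.
have I10 : (0 <= I1)%E by apply: integral_ge0 => w _; rewrite lee_fin G0//; lra.
have : ((1 + h)%:E * (n%:R * 2 + n%:R * 2)%:E <= h%:E * I1 + I2)%E.
  rewrite -EG /I1 /I2 -!ge0_integralZl//; last 3 first.
    by apply/measurable_EFinP; exact: mG.
    by move=> w _; rewrite lee_fin G0//; lra.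
    by rewrite lee_fin; lra.
  rewrite -ge0_integralD//; last 4 first.
    by move=> w _; rewrite -EFinM lee_fin mulr_ge0 ?(ltW h0)// G0.
    by apply/measurable_EFinP; exact: measurable_funM.
    by move=> w _; rewrite lee_fin G0//; lra.
    exact/measurable_EFinP.
  apply: ge0_le_integral => //.
  - by move=> w _; rewrite -EFinM lee_fin; apply: mulr_ge0; [lra|exact: (G0 2 2)].
  - by apply/measurable_EFinP; apply: measurable_funM => //; exact: mG.
  - by apply: emeasurable_funD; apply/measurable_EFinP; [exact: measurable_funM|exact: mG].
  - by move=> w _; rewrite -!EFinM -EFinD lee_fin; apply: lpp_bdw_convex; lra.
  - by apply/measurable_EFinP; exact: mG.
  - by move=> w _; rewrite lee_fin G0.
  - by rewrite lee_fin ltW.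
move: I1 I10 => [I1 _|_ _|]; [|by rewrite leey|by rewrite leeNy_eq].
move: I2 I20 I2le => [I2 _|_|]; [|by rewrite leye_eq|by rewrite leeNy_eq].
rewrite -!EFinM -!EFinD !lee_fin => I2le H.
rewrite -(ler_pM2l h0).
have -> : h * ((4 - 2 * h) * n%:R - 104 / h ^+ 3) = (4 * h - 2 * h ^+ 2) * n%:R - 104 / h ^+ 2.
  by field; exact: lt0r_neq0.
lra.
Qed.

(** Where a passage time [g] exceeds [C], it is at most [g ^ 2 / C]; the square is dominated by that
    of the stationary model with axes of mean 2. *)
Lemma integral_lpp_min h n C : 0 < h -> h <= 1 -> (0 < n)%N -> 0 < C ->
  (((4 - 2 * h) * n%:R - 104 / h ^+ 3 - (128 * n%:R + 32 * n%:R ^+ 2) / C)%:E <=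
   \int[P]_w (Num.min (L n n w) C)%:E)%E.
Proof.
move=> h0 h1 n0 C0.
have G11 w : 0 <= G 1 1 n n w by exact: G0.
have Lge0 w : 0 <= L n n w by exact: lpp_ge0.
have mmin : measurable_fun setT (fun w => Num.min (L n n w) C).
  exact: measurable_minr.
have m2 : measurable_fun setT (fun w => G 2 2 n n w ^+ 2) by exact: measurable_funX.
have : (\int[P]_w (G 1 1 n n w)%:E <= \int[P]_w (Num.min (L n n w) C)%:E +
     C^-1%:E * \int[P]_w (G 2 2 n n w ^+ 2)%:E)%E.
  rewrite -ge0_integralZl//; last 3 first.
    exact/measurable_EFinP.
    by move=> w _; rewrite lee_fin sqr_ge0.
    by rewrite lee_fin invr_ge0 ltW.
  rewrite -ge0_integralD//; last 4 first.
    by move=> w _; rewrite lee_fin le_min Lge0 ltW.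
    exact/measurable_EFinP.
    by move=> w _; rewrite -EFinM lee_fin mulr_ge0 ?sqr_ge0// invr_ge0 ltW.
    by apply/measurable_EFinP; exact: measurable_funM.
  apply: ge0_le_integral => //.
  - by move=> w _; rewrite lee_fin.
  - exact/measurable_EFinP.
  - by apply: emeasurable_funD; apply/measurable_EFinP => //; exact: measurable_funM.
  - move=> w _; rewrite -EFinM -EFinD lee_fin.
    have GL : G 1 1 n n w <= L n n w by exact: bdw1_le.
    have GG : G 1 1 n n w <= G 2 2 n n w.
      by apply: le_lpp => -[|i] [|j] _ _ //=; rewrite ler_wpM2r//; lra.
    have [gC|Cg] := leP (G 1 1 n n w) C.
      rewrite -[leLHS]addr0 lerD// ?le_min ?GL//.
      by rewrite mulr_ge0 ?sqr_ge0// invr_ge0 ltW.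
    rewrite -[leLHS]add0r lerD// ?le_min ?Lge0 ?(ltW C0)//.
    rewrite [C^-1 * _]mulrC ler_pdivlMr//; move: (G11 w); nra.
have I2 := integral_lpp_bdw_sqr n.
have I1 := integral_lpp_diag_ge h n h0 h1 n0.
move=> /(le_trans I1) {}I1.
have := le_trans I1 (leeD (lexx _) (lee_pmul _ _ (lexx C^-1%:E) I2)).
rewrite -EFinM => /(_ _ _) H.
rewrite EFinB leeBlDr//; apply: le_trans (H _ _) _.
- by rewrite lee_fin invr_ge0 ltW.
- by apply: integral_ge0 => w _; rewrite lee_fin sqr_ge0.
- by rewrite mulrC.
Qed.

End iid.

(** [n] and [C] depend on [eps] only, so one choice serves all environments and all diagonal blocks.
    The factor is [n.+1] because a block with corner [(n, n)] has side [n.+1]. *)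
Lemma lpp_diag_lower_bound {R : realType} (eps : R) : 0 < eps ->
  exists n C, 0 < C /\
    forall d (T : measurableType d) (P : probability T R) (X : nat -> nat -> T -> R),
    (forall i j, measurable_fun setT (X i j)) -> (forall i j w, 0 <= X i j w) ->
    joint_law P (fun p : nat * nat => X p.1 p.2) (fun=> expm 1) ->
    (((4 - eps) * n.+1%:R)%:E <=
     \int[P]_w (Num.min (lpp (fun i j => X i j w) n n) C)%:E)%E.
Proof.
move=> e0; pose h := Num.min (eps / 8) 1.
have h0 : 0 < h by rewrite lt_min ltr01 andbT; lra.
have h1 : h <= 1 by rewrite ge_min lexx orbT.
have he : h <= eps / 8 by rewrite ge_min lexx.
(* The 5 pays for the step from [n] to [n.+1], at most 4, and for the truncation loss, which is 1
   because [C] is the bound on the second moment. *)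
pose n := (Num.truncn (2 * (104 / h ^+ 3 + 5) / eps)).+1.
have nE : 2 * (104 / h ^+ 3 + 5) <= n%:R * eps.
  by rewrite -ler_pdivrMr// ltW// /n truncnS_gt.
have n0 : 0 < n%:R :> R by rewrite ltr0n.
pose C : R := 128 * n%:R + 32 * n%:R ^+ 2.
have C0 : 0 < C by rewrite /C; nra.
exists n, C; split => // d T P X mX X0 lawX.
apply: le_trans (integral_lpp_min P X mX X0 lawX h n C h0 h1 _ C0) => //.
rewrite lee_fin -/C divff ?lt0r_neq0// -natr1.
move: nE; set k := 104 / h ^+ 3; nra.
Qed.

(** * Convex order *)

Section resample.
Context {d} {T : measurableType d} {R : realType} (P : probability T R).
Context {I : eqType} (V : I -> T -> R) (nu : I -> probability (RT R) R) (i : I).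
Hypothesis mV : forall j, measurable_fun setT (V j).
Hypothesis lawV : joint_law P V nu.

(** A family closed under intersection that generates the sigma-algebra of the [V j] with [j != i].
    With this sigma-algebra, [T] becomes [T'] and stands for the remaining coordinates: [(w, V i w)]
    has a product law on [T' * R], so a single variable can be integrated out on an abstract
    space. *)
Definition other_boxes : set (set T) := [set A | exists s B,
  [/\ i \notin s, uniq s, (forall j, measurable (B j : set R)) & A = box V s B]].

Let T' := g_sigma_algebraType other_boxes.

Lemma setI_closed_other_boxes : setI_closed other_boxes.
Proof.
move=> _ _ [s [B [si us mB ->]]] [s' [B' [s'i us' mB' ->]]].
pose B2 j := (if j \in s then B j else setT) `&` (if j \in s' then B' j else setT).
exists (undup (s ++ s')), B2; split.
- by rewrite mem_undup mem_cat negb_or si.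
- exact: undup_uniq.
- by move=> j; apply: measurableI; case: ifP.
- apply/seteqP; split => w.
    move=> [Hs Hs'] j; rewrite mem_undup mem_cat /B2.
    by case: ifPn => js; case: ifPn => js' // _; split => //; (exact: Hs || exact: Hs').
  move=> H; split => j js; have := H j; rewrite mem_undup mem_cat js ?orbT /B2 js => /(_ isT)[].
    by [].
  by [].
Qed.

Lemma measurable_other A : <<s other_boxes >> A -> measurable A.
Proof.
apply: smallest_sub; first exact: sigma_algebra_measurable.
by move=> _ [s [B [_ _ mB ->]]]; exact: measurable_box.
Qed.

Lemma measurable_id_other : measurable_fun setT (id : T -> T').
Proof. by move=> _ A mA; rewrite setTI; exact: measurable_other. Qed.

Lemma measurable_other_var j : j != i -> measurable_fun setT (V j : T' -> R).
Proof.
move=> ji _ B mB; rewrite setTI; apply: sub_sigma_algebra.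
exists [:: j], (fun=> B); split => //.
- by rewrite inE eq_sym.
- by rewrite box_cons box_nil setIT.
Qed.

Lemma indep_other A C : <<s other_boxes >> A -> measurable C ->
  P (A `&` V i @^-1` C) = (P A * nu i C)%E.
Proof.
move=> mA mC.
have mVC : measurable (V i @^-1` C).
  by rewrite -[X in measurable X]setTI; exact: mV.
have c0 : 0 <= fine (nu i C) by exact: fine_ge0.
pose m1 : {measure set T' -> \bar R} :=
  image_measure (mrestr P mVC) measurable_id_other.
pose m2 : {measure set T' -> \bar R} :=
  mscale (NngNum c0) (image_law P measurable_id_other).
have m2E B : m2 B = ((fine (nu i C))%:E * P B)%E by [].
suff : m1 A = m2 A.
  by rewrite m2E fineK ?fin_num_measure// muleC.
apply: (@measure_unique _ R T' other_boxes (fun=> setT)) => //.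
- exact: setI_closed_other_boxes.
- by move=> _; exists [::], (fun=> setT); rewrite box_nil; split.
- by rewrite bigcup_const//; exists 0%N.
- move=> _ [s [B [si us mB ->]]].
  rewrite m2E fineK ?fin_num_measure//.
  pose B' j := if j == i then C else B j.
  have mB' j : measurable (B' j) by rewrite /B'; case: ifP.
  have uis : uniq (i :: s) by rewrite /= si us.
  have BB' : {in s, forall j, B' j = B j}.
    by move=> j js; rewrite /B'; case: eqP => // ji; rewrite -ji js in si.
  have := lawV (i :: s) B' uis mB'.
  have B'i : B' i = C by rewrite /B' eqxx.
  rewrite box_cons big_cons B'i.
  have -> : box V s B' = box V s B.
    by apply/seteqP; split => w H j js; move: (H j js); rewrite BB'.
  rewrite (eq_big_seq (fun j => nu j (B j))); last by move=> j js; rewrite BB'.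
  by rewrite -(lawV s B us mB) setIC.
- move=> _; apply: (@le_lt_trans _ _ 1%E); last exact: ltry.
  by apply: (probability_le1 P); exact: (measurableI _ _ (@measurableT _ T) mVC).
Qed.

Lemma ge0_resample (F : T' * RT R -> \bar R) : measurable_fun setT F ->
  (forall z, (0 <= F z)%E) ->
  (\int[P]_w F (w, V i w) =
   \int[image_law P measurable_id_other]_w \int[nu i]_x F (w, x))%E.
Proof.
move=> mF F0.
have mZ : measurable_fun setT (fun w : T => ((w : T'), V i w : RT R)).
  by apply: measurable_fun_pair; [exact: measurable_id_other|exact: mV].
rewrite (ge0_integral_law P (image_law P measurable_id_other \x nu i)%E _ F mZ)//.
  by rewrite (fubini_tonelli1 F).
move=> B mB; rewrite -[RHS]mul1e.
suff : image_law P mZ B = (1%:E * (image_law P measurable_id_other \x nu i) B)%E by [].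
apply: product_measure_scale_unique => // A C mA mC.
rewrite mul1e; exact: indep_other.
Qed.

Lemma ge0_resample_le (F1 F2 : T' * RT R -> \bar R) :
  measurable_fun setT F1 -> measurable_fun setT F2 ->
  (forall z, (0 <= F1 z)%E) -> (forall z, (0 <= F2 z)%E) ->
  (forall w, (\int[nu i]_x F1 (w, x) <= \int[nu i]_x F2 (w, x))%E) ->
  (\int[P]_w F1 (w, V i w) <= \int[P]_w F2 (w, V i w))%E.
Proof.
move=> mF1 mF2 F10 F20 F12; rewrite !ge0_resample//.
apply: ge0_le_integral => //.
- by move=> w _; apply: integral_ge0.
- exact: (measurable_fun_fubini_tonelli_F (m2 := nu i) F1).
- exact: (measurable_fun_fubini_tonelli_F (m2 := nu i) F2).
Qed.

End resample.

Section convex_order.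
Context {R : realType}.

(* existence of nonnegative subgradients, i.e. convexity and monotonicity *)
Definition subdiff (f : R -> R) :=
  forall y, exists2 k, 0 <= k & forall z, f y + k * (z - y) <= f z.

Lemma subdiff_cst c : subdiff (fun=> c).
Proof. by move=> y; exists 0 => // z; rewrite mul0r addr0. Qed.

Lemma subdiff_id : subdiff id.
Proof. by move=> y; exists 1 => // z; lra. Qed.

Lemma subdiffD f g : subdiff f -> subdiff g -> subdiff (fun y => f y + g y).
Proof.
move=> sf sg y; have [k k0 Hk] := sf y; have [l l0 Hl] := sg y.
by exists (k + l); [exact: addr_ge0|move=> z; have := Hk z; have := Hl z; lra].
Qed.

Lemma subdiff_max f g : subdiff f -> subdiff g -> subdiff (fun y => Num.max (f y) (g y)).
Proof.
move=> sf sg y; have [fg|gf] := leP (f y) (g y).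
  by have [k k0 Hk] := sg y; exists k => // z; rewrite le_max Hk orbT.
by have [k k0 Hk] := sf y; exists k => // z; rewrite le_max Hk.
Qed.

Lemma subdiff_lpp (u : nat -> nat -> R) (p : nat * nat) n m :
  subdiff (fun y => lpp (fun i j => if (i, j) == p then y else u i j) n m).
Proof.
have sw i j : subdiff (fun y => if (i, j) == p then y else u i j).
  by case: eqP => _; [exact: subdiff_id|exact: subdiff_cst].
move: n m; apply: lpp_ind => [|m IH|n IH|n m IH1 IH2].
- by under eq_fun do rewrite lpp00; exact: sw.
- by under eq_fun do rewrite lppS0; exact: subdiffD.
- by under eq_fun do rewrite lpp0S; exact: subdiffD.
- by under eq_fun do rewrite lppSS; apply: subdiffD => //; exact: subdiff_max.
Qed.

(* The law of [(s + e) X] dominates that of [s X + e] in the convex order when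
   [E X = 1]: the difference of the two variables is [e (X - 1)]. *)
Lemma subdiff_exp1 (f : R -> R) (s e : R) : subdiff f -> 0 < s -> 0 <= e ->
  measurable_fun setT f -> (forall y, 0 <= y -> 0 <= f y) ->
  (\int[expm 1]_x (f (s * Num.max 0 x + e))%:E <=
   \int[expm 1]_x (f ((s + e) * Num.max 0 x))%:E)%E.
Proof.
move=> sf s0 e0 mf f0.
have [k k0 Hk] := sf (s + e).
have mp : measurable_fun setT (fun x : RT R => Num.max 0 x : R) by exact: measurable_maxr.
have p0 (x : R) : 0 <= Num.max 0 x by rewrite le_max lexx.
have mf1 : measurable_fun setT (fun x : RT R => f (s * Num.max 0 x + e)).
  apply: measurableT_comp => //; apply: measurable_funD => //.
  exact: measurable_funM.
have mf2 : measurable_fun setT (fun x : RT R => f ((s + e) * Num.max 0 x)).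
  apply: measurableT_comp => //; exact: measurable_funM.
(* [k] is a subgradient at [s + e], the value both arguments take at [x = 1]. The two added terms
   have the same finite integral and cancel at the end. *)
have : (\int[expm 1]_x ((f (s * Num.max 0 x + e))%:E + (k * e)%:E * (Num.max 0 x)%:E) <=
   \int[expm 1]_x ((f ((s + e) * Num.max 0 x))%:E + (k * e)%:E))%E.
  apply: ge0_le_integral => //.
  - by move=> x _; rewrite -EFinM -EFinD lee_fin addr_ge0 ?f0 ?mulr_ge0 ?addr_ge0 ?mulr_ge0// ltW.
  - apply: emeasurable_funD; apply/measurable_EFinP => //; exact: measurable_funM.
  - by apply: emeasurable_funD => //; apply/measurable_EFinP.
  - move=> x _; rewrite -EFinM -!EFinD lee_fin.
    set p := Num.max 0 x.
    have [l l0 Hl] := sf (s * p + e).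
    have h1 := Hl ((s + e) * p); have h2 := Hl (s + e); have h3 := Hk (s * p + e).
    (* monotonicity of the subgradient *)
    have mono : 0 <= (l - k) * (p - 1).
      rewrite -(pmulr_rge0 _ s0); nra.
    have : 0 <= e * ((l - k) * (p - 1)) by exact: mulr_ge0.
    nra.
rewrite ge0_integralD//; last 4 first.
  by move=> x _; rewrite lee_fin f0// addr_ge0// mulr_ge0// ltW.
  exact/measurable_EFinP.
  by move=> x _; rewrite mule_ge0// lee_fin ?mulr_ge0.
  by apply/measurable_EFinP; exact: measurable_funM.
rewrite ge0_integralD//; last 3 first.
  by move=> x _; rewrite lee_fin f0// mulr_ge0// addr_ge0// ltW.
  exact/measurable_EFinP.
  by move=> x _; rewrite lee_fin mulr_ge0.
rewrite ge0_integralZl//; last 3 first.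
  exact/measurable_EFinP.
  by move=> x _; rewrite lee_fin.
  by rewrite lee_fin mulr_ge0.
rewrite integral_expm// mule1 integral_cst// [X in (_ + _ * X)%E]probability_setT mule1.
by rewrite leeD2rE.
Qed.

End convex_order.

(** * Comparison with the slowest rate *)

Section convex_order_lpp.
Context {d} {T : measurableType d} {R : realType} (P : probability T R).
Variables (X : nat -> nat -> T -> R).
Hypothesis mX : forall i j, measurable_fun setT (X i j).
Hypothesis X0 : forall i j w, 0 <= X i j w.
Hypothesis lawX : joint_law P (fun p : nat * nat => X p.1 p.2) (fun=> expm 1).
Variables (S E : nat -> nat -> R).
Hypotheses (S0 : forall i j, 0 < S i j) (E0 : forall i j, 0 <= E i j).

(** [l] lists the vertices whose weight has already been replaced by the larger one in the convex
    order. *)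
Let W (l : seq (nat * nat)) i j (x : R) : R :=
  if (i, j) \in l then (S i j + E i j) * x else S i j * x + E i j.

Let W0 l i j x : 0 <= x -> 0 <= W l i j x.
Proof.
by move=> x0; rewrite /W; case: ifP => _; rewrite ?addr_ge0// mulr_ge0// ?addr_ge0// ltW.
Qed.

(** With all other weights frozen, the passage time is a convex nondecreasing function of the weight
    at [p], so the one-variable comparison applies under the integral over the rest. *)
Lemma integral_lpp_convex_step l p n m : p \notin l ->
  (\int[P]_w (lpp (fun i j => W l i j (X i j w)) n m)%:E <=
   \int[P]_w (lpp (fun i j => W (p :: l) i j (X i j w)) n m)%:E)%E.
Proof.
move=> pl; pose V (q : nat * nat) := X q.1 q.2.
have mV q : measurable_fun setT (V q) by exact: mX.
have V0 q w : 0 <= V q w by exact: X0.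
pose U (g : R -> R) (z : g_sigma_algebraType (other_boxes V p) * RT R) (i j : nat) : R :=
  if (i, j) == p then g (Num.max 0 (z.2 : R)) else W l i j (X i j z.1).
have mU g : measurable_fun setT g -> forall i j, measurable_fun setT (fun z => U g z i j).
  move=> mg i j; rewrite /U; case: eqP => [_|/eqP ijp].
    by apply: measurableT_comp => //; exact: measurable_maxr.
  have mXij : measurable_fun setT (fun z : g_sigma_algebraType (other_boxes V p) * RT R => X i j z.1).
    apply: (measurableT_comp (f := X i j : g_sigma_algebraType (other_boxes V p) -> R)) => //.
    exact: (measurable_other_var V p (i, j) ijp).
  rewrite /W; case: ((i, j) \in l); first exact: measurable_funM.
  by apply: measurable_funD => //; exact: measurable_funM.
pose g1 (x : R) := S p.1 p.2 * x + E p.1 p.2.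
pose g2 (x : R) := (S p.1 p.2 + E p.1 p.2) * x.
have mg1 : measurable_fun setT g1 by apply: measurable_funD => //; exact: measurable_funM.
have mg2 : measurable_fun setT g2 by exact: measurable_funM.
have U0 g z : (forall x, 0 <= x -> 0 <= g x) -> forall i j, 0 <= U g z i j.
  by move=> g0 i j; rewrite /U; case: eqP => _; [rewrite g0// le_max lexx|exact: W0].
have g10 x : 0 <= x -> 0 <= g1 x by move=> x0; rewrite addr_ge0// mulr_ge0// ltW.
have g20 x : 0 <= x -> 0 <= g2 x by move=> x0; rewrite mulr_ge0// addr_ge0// ltW.
have E1 : (\int[P]_w (lpp (fun i j => W l i j (X i j w)) n m)%:E =
    \int[P]_w (fun z => (lpp (U g1 z) n m)%:E) (w, V p w))%E.
  apply: eq_integral => w _; congr EFin; apply: eq_lpp => i j _ _; rewrite /U /=.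
  by case: eqP => // ijp; rewrite (max_r (V0 _ _)) /W ijp (negbTE pl) /g1 /V -ijp.
have E2 : (\int[P]_w (lpp (fun i j => W (p :: l) i j (X i j w)) n m)%:E =
    \int[P]_w (fun z => (lpp (U g2 z) n m)%:E) (w, V p w))%E.
  apply: eq_integral => w _; congr EFin; apply: eq_lpp => i j _ _; rewrite /U /=.
  rewrite /W inE; case: eqP => //= ijp; by rewrite (max_r (V0 _ _)) /g2 /V -ijp.
rewrite E1 E2; apply: (@ge0_resample_le _ _ _ P _ V (fun=> expm 1) p mV lawX
  (fun z => (lpp (U g1 z) n m)%:E) (fun z => (lpp (U g2 z) n m)%:E)).
- by apply/measurable_EFinP; apply: measurable_lpp => i j; exact: mU.
- by apply/measurable_EFinP; apply: measurable_lpp => i j; exact: mU.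
- by move=> z; rewrite lee_fin; apply: lpp_ge0; exact: U0.
- by move=> z; rewrite lee_fin; apply: lpp_ge0; exact: U0.
move=> w.
pose f y := lpp (fun i j => if (i, j) == p then y else W l i j (X i j w)) n m.
have := @subdiff_exp1 R f (S p.1 p.2) (E p.1 p.2) (subdiff_lpp _ _ _ _) (S0 _ _) (E0 _ _).
apply.
- apply: measurable_lpp => i j; case: eqP => _; exact: measurable_cst || exact: measurable_id.
- by move=> y y0; apply: lpp_ge0 => i j; case: eqP => // _; exact: W0.
Qed.

Lemma integral_lpp_convex_order n m :
  (\int[P]_w (lpp (fun i j => S i j * X i j w + E i j) n m)%:E <=
   \int[P]_w (lpp (fun i j => (S i j + E i j) * X i j w) n m)%:E)%E.
Proof.
have H l : uniq l -> (\int[P]_w (lpp (fun i j => S i j * X i j w + E i j) n m)%:E <=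
   \int[P]_w (lpp (fun i j => W l i j (X i j w)) n m)%:E)%E.
  elim: l => [_//|p l IH /= /andP[pl ul]].
  exact: le_trans (IH ul) (integral_lpp_convex_step l p n m pl).
pose l := [seq (i, j) | i <- iota 0 m.+1, j <- iota 0 n.+1].
have ul : uniq l.
  apply: allpairs_uniq; [exact: iota_uniq|exact: iota_uniq|].
  by move=> [? ?] [? ?].
apply: (le_trans (H l ul)); rewrite le_eqVlt; apply/orP; left; apply/eqP.
apply: eq_integral => w _; congr EFin; apply: eq_lpp => i j im jn.
rewrite /W ifT//; apply/allpairsP; exists (i, j).
by split => //; rewrite mem_iota add0n ltnS.
Qed.

End convex_order_lpp.

(** * Mean passage time in an environment bounded below *)

Section disorder.
Context {d} {T : measurableType d} {R : realType} (P : probability T R).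
Variables (X : nat -> nat -> T -> R).
Hypothesis mX : forall i j, measurable_fun setT (X i j).
Hypothesis X0 : forall i j w, 0 <= X i j w.
Hypothesis lawX : joint_law P (fun p : nat * nat => X p.1 p.2) (fun=> expm 1).

(* A path from column [0] to column [m - n] visits all the columns in between. *)
Definition columns (e : int -> R) (m n : nat) : R :=
  \sum_(k < m - n) e k.+1%:Z + \sum_(k < n - m) e (- k.+1%:Z).

(** [columns e] is a potential: a step away from column 0 raises it by the value at the column
    entered, and a step towards column 0 does not raise it. *)
Lemma lpp_add_columns (w : nat -> nat -> R) (e : int -> R) n m : (forall z, 0 <= e z) ->
  lpp w n m + columns e m n <= lpp (fun i j => w i j + e (i%:Z - j%:Z)) n m.
Proof.
move=> e0; apply: (lpp_add_potential w (fun i j => e (i%:Z - j%:Z)) (columns e)).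
- by rewrite /columns !subn0 !big_ord0 addr0.
- move=> i j; rewrite /columns; have [ji|ij] := leqP j i.
    rewrite subSn// big_ord_recr /=.
    have -> : (j - i.+1 = 0)%N by lia.
    have -> : (j - i = 0)%N by lia.
    have -> : (i - j).+1%:Z = i.+1%:Z - j%:Z by lia.
    by rewrite !big_ord0 !addr0.
  have -> : (i.+1 - j = 0)%N by lia.
  have -> : (i - j = 0)%N by lia.
  have -> : (j - i = (j - i.+1).+1)%N by lia.
  by rewrite [X in _ <= _ + X + _]big_ord_recr /= !big_ord0 !add0r -addrA lerDl addr_ge0.
- move=> i j; rewrite /columns; have [ij|ji] := leqP i j.
    rewrite (subSn ij) big_ord_recr /=.
    have -> : (i - j.+1 = 0)%N by lia.
    have -> : (i - j = 0)%N by lia.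
    have -> : - (j - i).+1%:Z = i%:Z - j.+1%:Z by lia.
    by rewrite !big_ord0 !add0r.
  have -> : (j.+1 - i = 0)%N by lia.
  have -> : (j - i = 0)%N by lia.
  have -> : (i - j = (i - j.+1).+1)%N by lia.
  by rewrite [X in _ <= X + _ + _]big_ord_recr /= !big_ord0 !addr0 -addrA lerDl addr_ge0.
Qed.

Lemma integral_lpp_disorder_le (a : int -> R) (r : R) n m : 0 < r ->
  (forall z, r <= a z) ->
  (\int[P]_w (lpp (fun i j => X i j w / a (i%:Z - j%:Z)) n m)%:E +
     (columns (fun z => r^-1 - (a z)^-1) m n)%:E <=
   ((2 * (n + m)%:R + 1) / r)%:E)%E.
Proof.
move=> r0 ra; have a0 z : 0 < a z by exact: lt_le_trans (ra z).
pose S i j : R := (a (i%:Z - j%:Z))^-1.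
pose e z : R := r^-1 - (a z)^-1.
have e0 z : 0 <= e z by rewrite subr_ge0 lef_pV2// posrE.
have S0 i j : 0 < S i j by rewrite invr_gt0.
have mS i j : measurable_fun setT (fun w => S i j * X i j w) by exact: measurable_funM.
have c0 : 0 <= columns e m n by rewrite addr_ge0// sumr_ge0.
apply: (@le_trans _ _ (\int[P]_w (lpp (fun i j => S i j * X i j w + e (i%:Z - j%:Z)) n m)%:E)%E).
  rewrite -(mule1 (columns _ _ _)%:E) -[in leLHS](@probability_setT _ _ _ P).
  rewrite -integral_cst// -ge0_integralD//.
  - apply: ge0_le_integral => //.
    + move=> w _; rewrite -EFinD lee_fin addr_ge0// lpp_ge0// => i j.
      by rewrite divr_ge0// ltW.
    + apply: emeasurable_funD => //; apply/measurable_EFinP.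
      by apply: measurable_lpp => i j; exact: measurable_funM.
    + by apply/measurable_EFinP; apply: measurable_lpp => i j; exact: measurable_funD.
    + move=> w _; rewrite -EFinD lee_fin.
      apply: le_trans (lpp_add_columns _ _ _ _ e0); rewrite lerD2r.
      by apply: le_lpp => i j _ _; rewrite mulrC.
  - by move=> w _; rewrite lee_fin lpp_ge0// => i j; rewrite divr_ge0// ltW.
  - by apply/measurable_EFinP; apply: measurable_lpp => i j; exact: measurable_funM.
apply: (le_trans (integral_lpp_convex_order P X mX X0 lawX S (fun i j => e (i%:Z - j%:Z))
  S0 (fun i j => e0 _) n m)).
rewrite (eq_integral (fun w => r^-1%:E * (lpp (fun i j => X i j w) n m)%:E)%E); last first.
  move=> w _; rewrite -EFinM -lppZ ?invr_ge0 ?ltW//; congr EFin.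
  by apply: eq_lpp => i j _ _; rewrite /S /e addrC subrK.
rewrite ge0_integralZl//.
- rewrite mulrC EFinM; apply: lee_pmul => //.
  + by rewrite lee_fin invr_ge0 ltW.
  + by apply: integral_ge0 => w _; rewrite lee_fin lpp_ge0.
  + exact: integral_lpp_le.
- by apply/measurable_EFinP; exact: measurable_lpp.
- by move=> w _; rewrite lee_fin lpp_ge0.
- by rewrite lee_fin invr_ge0 ltW.
Qed.

End disorder.

(** * Paths in the original coordinates and the recursion *)

Section paths.
Context {R : realType}.
Implicit Types (Y : int -> int -> R).

Definition site (m n : nat) : int * int := (m%:Z - n%:Z, n%:Z).

Lemma inW_site m n : inW (site m n).
Proof. by rewrite /inW /site /= subrK. Qed.

Lemma inWP z : inW z -> exists m n, z = site m n.
Proof.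
case: z => x y /andP[/= y0 xy0]; exists (absz (x + y)), (absz y).
by rewrite /site !gez0_abs// addrK.
Qed.

Definition site_weight Y (i j : nat) : R := Y (i%:Z - j%:Z) j%:Z.

Lemma sum_path_rcons Y (g : seq (int * int)) z :
  \sum_(p <- (0, 0) :: rcons g z) Y p.1 p.2 =
  \sum_(p <- (0, 0) :: g) Y p.1 p.2 + Y z.1 z.2.
Proof. by rewrite -cats1 -cat_cons big_cat/= big_seq1. Qed.

Lemma lpp_path_le Y g m n : lpp_path (site m n) g ->
  \sum_(p <- (0, 0) :: g) Y p.1 p.2 <= lpp (site_weight Y) n m.
Proof.
elim/last_ind: g m n => [|g z IH] m n.
  move=> /and3P[_ /eqP [] mn n0 _]; rewrite big_seq1 /=.
  have {}n0 : n = 0%N by lia.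
  have {mn} m0 : m = 0%N by lia.
  by rewrite n0 m0 lpp00 /site_weight subrr.
rewrite /lpp_path rcons_path last_rcons -rcons_cons all_rcons.
move=> /and3P[/andP[pg st] /eqP zE /andP[_ gW]].
rewrite sum_path_rcons; move: st; rewrite zE.
have : inW (last (0, 0) g) by apply: (allP gW); exact: mem_last.
move=> /inWP[m' [n' gE]]; rewrite gE.
have {}IH := IH m' n'.
have {}IH : \sum_(p <- (0, 0) :: g) Y p.1 p.2 <= lpp (site_weight Y) n' m'.
  by apply: IH; rewrite /lpp_path pg gE eqxx.
rewrite /lpp_step /site !xpair_eqE /= => /orP[] /andP[/eqP h1 /eqP h2].
  have -> : n = n' by lia.
  have -> : m = m'.+1 by lia.
  apply: le_trans (lpp_stepr _ _ _); exact: lerD.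
have -> : n = n'.+1 by lia.
have -> : m = m' by lia.
apply: le_trans (lpp_stepu _ _ _); exact: lerD.
Qed.

Lemma lpp_path_ex Y m n : exists2 g, lpp_path (site m n) g &
  \sum_(p <- (0, 0) :: g) Y p.1 p.2 = lpp (site_weight Y) n m.
Proof.
have ext g m1 n1 m2 n2 : lpp_path (site m1 n1) g -> lpp_step (site m1 n1) (site m2 n2) ->
    lpp_path (site m2 n2) (rcons g (site m2 n2)).
  move=> /and3P[pg /eqP gE gW] st.
  rewrite /lpp_path rcons_path last_rcons -rcons_cons all_rcons pg gE st eqxx.
  by rewrite inW_site gW.
have stepr m1 n1 : lpp_step (site m1 n1) (site m1.+1 n1).
  by apply/orP; left; apply/eqP; rewrite /site; congr pair; rewrite /=; lia.
have stepu m1 n1 : lpp_step (site m1 n1) (site m1 n1.+1).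
  by apply/orP; right; apply/eqP; rewrite /site; congr pair; rewrite /=; lia.
move: n m; apply: lpp_ind => [|m [g Hg Eg]|n [g Hg Eg]|n m [g1 Hg1 Eg1] [g2 Hg2 Eg2]].
- exists [::]; first by [].
  by rewrite big_seq1 lpp00 /site_weight subrr.
- by exists (rcons g (site m.+1 0)); [exact: ext Hg _|rewrite sum_path_rcons Eg lppS0].
- by exists (rcons g (site 0 n.+1)); [exact: ext Hg _|rewrite sum_path_rcons Eg lpp0S].
- rewrite lppSS; have [h|h] := leP (lpp (site_weight Y) n.+1 m) (lpp (site_weight Y) n m.+1).
    by exists (rcons g2 (site m.+1 n.+1)); [exact: ext Hg2 _|rewrite sum_path_rcons Eg2].
  by exists (rcons g1 (site m.+1 n.+1)); [exact: ext Hg1 _|rewrite sum_path_rcons Eg1].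
Qed.

Lemma lpp_TE Y m n : lpp_T Y (site m n) = lpp (site_weight Y) n m.
Proof.
have [g Hg Eg] := lpp_path_ex Y m n.
apply/eqP; rewrite eq_le; apply/andP; split.
  apply: ge_sup; first by exists (\sum_(p <- (0, 0) :: g) Y p.1 p.2), g.
  by move=> _ [g' Hg' <-]; exact: lpp_path_le.
apply: ub_le_sup; last by exists g.
by exists (lpp (site_weight Y) n m) => _ [g' Hg' <-]; exact: lpp_path_le.
Qed.

End paths.

(** * Passing to the limit *)

Section limits.
Context {d} {T : measurableType d} {R : realType} (P : probability T R).

Lemma ae_mono2 (A B C : T -> Prop) : (forall x, A x -> B x -> C x) ->
  {ae P, forall x, A x} -> {ae P, forall x, B x} -> {ae P, forall x, C x}.
Proof. by move=> H HA HB; apply: filterS2 HA HB => x; exact: H. Qed.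

Lemma ae_ex (A : T -> Prop) (B : set T) : measurable B -> (0 < P B)%E ->
  {ae P, forall x, A x} -> exists2 x, A x & B x.
Proof.
move=> mB PB [N [mN N0 AN]]; apply: contrapT => H.
suff : (P B <= P N)%E by rewrite N0 leNgt PB.
apply: le_measure; [exact: mem_set|exact: mem_set|move=> x Bx].
by apply: AN => Ax; apply: H; exists x.
Qed.

(** Only almost sure convergence is available; truncation at [K] supplies the dominating
    function. *)
Lemma cvg_integral_min (f : nat -> T -> R) (c K : R) :
  (forall n, measurable_fun setT (f n)) -> (forall n x, 0 <= f n x) -> 0 <= K ->
  {ae P, forall x, f n x @[n --> \oo] --> c} ->
  (\int[P]_x (Num.min (f n x) K)%:E)%E @[n --> \oo] --> (Num.min c K)%:E.
Proof.
move=> mf f0 K0 fc.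
have mfn n : measurable_fun setT (fun x => (Num.min (f n x) K)%:E).
  by apply/measurable_EFinP; exact: measurable_minr.
have fmin : {ae P, forall x, [set: T] x ->
    (Num.min (f n x) K)%:E @[n --> \oo] --> (Num.min c K)%:E}.
  apply: filterS fc => x fc _; apply: cvg_EFin; first exact: nearW.
  have mc : (Num.min y K : R) @[y --> c] --> (Num.min c K : R).
    by apply: (@continuous_min _ _ id (fun=> K)) => //; exact: cvg_cst.
  exact: (cvg_comp _ _ fc mc).
have fbound : {ae P, forall x n, [set: T] x ->
    (`|(Num.min (f n x) K)%:E| <= (EFin \o cst K) x)%E}.
  apply: aeW => x n _ /=; rewrite lee_fin ger0_norm ?le_min ?f0//.
  by rewrite ge_min lexx orbT.
have [_ _] := dominated_convergence measurableT mfn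
  (measurable_cst (Num.min c K)%:E) fmin
  (finite_measure_integrable_cst P K measurableT) fbound.
by rewrite integral_cst// [X in (_ * X)%E]probability_setT mule1.
Qed.

End limits.

Lemma cvg_le_of_rate {R : realType} (u : nat -> \bar R) (l L C : R) :
  u n @[n --> \oo] --> l%:E ->
  (forall n, (0 < n)%N -> (u n <= (L + C / n%:R)%:E)%E) -> l <= L.
Proof.
move=> ul uL; rewrite -lee_fin; apply/lee_addgt0Pr => e e0.
apply: cvge_le ul; exists (Num.truncn (`|C| / e)).+1 => // n /= en.
have n0 : (0 < n)%N by exact: leq_trans en.
apply: (le_trans (uL n n0)); rewrite -EFinD lee_fin lerD2l ler_pdivrMr ?ltr0n//.
apply: (le_trans (ler_norm C)); rewrite mulrC -ler_pdivrMr//.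
by apply: (le_trans (ltW (truncnS_gt _))); rewrite ler_nat.
Qed.

Lemma cvg_ge_of_rate {R : realType} (u : nat -> \bar R) (l L C : R) :
  u n @[n --> \oo] --> l%:E ->
  (forall n, (0 < n)%N -> ((L - C / n%:R)%:E <= u n)%E) -> L <= l.
Proof.
move=> ul uL; rewrite -lerN2.
apply: (@cvg_le_of_rate _ (fun n => - u n)%E _ _ C).
  by rewrite EFinN; exact: cvgeN.
by move=> n n0; rewrite leeNl (le_trans _ (uL n n0))// -EFinN lee_fin opprD opprK.
Qed.

Lemma lpp_le_diag {R : realType} (w : nat -> nat -> R) a b : (forall i j, 0 <= w i j) ->
  (a <= b)%N -> lpp w a a <= lpp w b b.
Proof.
move=> w0 /subnK <-; elim: (b - a)%N => [//|k IH].
by rewrite addSn (le_trans IH)// (le_trans (lpp_leu _ _ _ w0))// lpp_ler.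
Qed.

(** Paths through [q] consecutive diagonal squares of side [N.+1]. Inside these squares they stay
    within distance [N] of the diagonal, hence in a fixed finite set of columns. *)
Lemma lpp_blocks {R : realType} (w : nat -> nat -> R) N q k : (forall i j, 0 <= w i j) ->
  (q * N.+1 <= k.+1)%N ->
  \sum_(b < q) lpp (fun i j => w (b * N.+1 + i)%N (b * N.+1 + j)%N) N N <= lpp w k k.
Proof.
move=> w0; case: q => [|q] qk; first by rewrite big_ord0 lpp_ge0.
apply: (@le_trans _ _ (lpp w (q * N.+1 + N) (q * N.+1 + N))); last first.
  by apply: lpp_le_diag => //; move: qk; rewrite mulSn; lia.
elim: q {qk} => [|q IH].
  by rewrite big_ord1; rewrite le_eqVlt; apply/orP; left; apply/eqP/eq_lpp.
have -> : (q.+1 * N.+1 + N = (q * N.+1 + N).+1 + N)%N by lia.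
rewrite big_ord_recr; apply: (le_trans (lerD IH (lexx _))).
apply: le_trans (lpp_superadd w _ _ _ _ w0); rewrite lerD2l.
rewrite le_eqVlt; apply/orP; left; apply/eqP; apply: eq_lpp => i j _ _.
by congr (w _ _); rewrite /=; lia.
Qed.

Lemma sum_min_le {R : realType} q (g : 'I_q -> R) C :
  \sum_(b < q) Num.min (g b) C <= Num.min (\sum_(b < q) g b) (q%:R * C).
Proof.
rewrite le_min; apply/andP; split.
  by apply: ler_sum => b _; rewrite ge_min lexx.
rewrite -[in leRHS](card_ord q) -sum1_card natr_sum mulr_suml.
by apply: ler_sum => b _; rewrite mul1r ge_min lexx orbT.
Qed.

(** * Quenched weights as rescaled unit exponentials *)

Section environment.
Context {d} {T : measurableType d} {R : realType} (Q : probability T R).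
Variables (a : int -> R) (Y : int -> int -> T -> R).
Hypothesis a0 : forall i, 0 < a i.
Hypothesis mY : forall i j, measurable_fun setT (Y i j).
Hypothesis indepY : mutually_independent Q (fun p : int * int => Y p.1 p.2).
Hypothesis lawY : forall i j, exp_law Q (a i) (Y i j).

(* the positive part only matters on a null set *)
Definition unit_weight (i j : nat) (w : T) : R :=
  Num.max 0 (a (i%:Z - j%:Z) * Y (i%:Z - j%:Z) j%:Z w).

Lemma measurable_unit_weight i j : measurable_fun setT (unit_weight i j).
Proof. by apply: measurable_maxr => //; exact: measurable_funM. Qed.

Lemma unit_weight_ge0 i j w : 0 <= unit_weight i j w.
Proof. by rewrite le_max lexx. Qed.

Lemma exp1_max0 (B : set R) : measurable B ->
  @exp1 R ((fun x => Num.max 0 x) @^-1` B) = exp1 B.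
Proof.
move=> mB.
have mp : measurable_fun setT (fun x : RT R => Num.max 0 x : RT R) by exact: measurable_maxr.
suff : image_law (@exp1 R) mp B = exp1 B by [].
apply: measure_ray_unique mB => [k|].
  transitivity (@exp1 R ((fun x : RT R => Num.max 0 x : RT R) @^-1` `]k, +oo[%classic)) => //.
  have [k0|k0] := leP 0 k.
    congr (exp1 _); apply/seteqP; split => x /=; rewrite !in_itv/= !andbT lt_max (ltNge k 0) k0//.
  rewrite [RHS]exponential_prob_ray// max_l ?ltW// mulr0 expR0.
  rewrite (_ : _ @^-1` _ = setT) ?[LHS]probability_setT//.
  by apply/seteqP; split => // x _ /=; rewrite in_itv/= andbT lt_max k0.
exact: le_lt_trans (probability_le1 (image_law exp1 mp) measurableT) (ltry 1).
Qed.

Lemma joint_law_unit_weight :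
  joint_law Q (fun p : nat * nat => unit_weight p.1 p.2) (fun=> expm 1).
Proof.
move=> s B us mB.
pose st (p : nat * nat) := site p.1 p.2.
pose inv (z : int * int) : nat * nat := (absz (z.1 + z.2), absz z.2).
have stK : cancel st inv by move=> [i j]; rewrite /inv /st /site /= subrK.
pose B' (z : int * int) : set R := [set y | B (inv z) (Num.max 0 (a z.1 * y))].
have mB' z : measurable (B' z).
  have mg : measurable_fun setT (fun y : R => Num.max 0 (a z.1 * y)).
    by apply: measurable_maxr => //; exact: measurable_funM.
  by rewrite /B' -[X in measurable X]setTI; exact: mg.
pose F := seq_fset tt (map st s).
have := indepY F B' mB'.
have -> : \bigcap_(i in [set` F]) (Y i.1 i.2 @^-1` B' i) =
    box (fun p : nat * nat => unit_weight p.1 p.2) s B.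
  apply/seteqP; split => w H p.
    move=> ps; have := H (st p); rewrite /= seq_fsetE map_f// => /(_ isT).
    by rewrite /B' /= stK.
  rewrite /= seq_fsetE => /mapP[p' p's ->]; have := H p' p's.
  by rewrite /B' /= stK.
move=> ->; rewrite (perm_big (map st s)); last first.
  apply: uniq_perm; first exact: fset_uniq.
    by rewrite map_inj_uniq//; exact: can_inj stK.
  by move=> z; rewrite seq_fsetE.
rewrite big_map; apply: eq_bigr => p _.
rewrite lawY// exponential_probE// expm1.
rewrite -(exp1_max0 _ (mB p)) /expm /= /distribution /pushforward /=.
congr exponential_prob; apply/seteqP; split => x;
  by rewrite /B' /preimage /= stK /scale mulrA divff ?mul1r// lt0r_neq0.
Qed.

Lemma ae_unit_weight : {ae Q, forall w, forall i j : nat,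
  Y (i%:Z - j%:Z) j%:Z w = unit_weight i j w / a (i%:Z - j%:Z)}.
Proof.
suff H (i j : nat) : {ae Q, forall w, Y (i%:Z - j%:Z) j%:Z w = unit_weight i j w / a (i%:Z - j%:Z)}.
  by apply: ae_foralln => i; apply: ae_foralln => j; exact: H.
set z := i%:Z - j%:Z.
exists (Y z j @^-1` `]-oo, 0[%classic); split.
- by rewrite -[X in measurable X]setTI; exact: mY.
- by rewrite lawY// exponential_prob_lt0.
- move=> w /=; apply: contra_notP => /negP; rewrite in_itv/= -leNgt => Y0.
  rewrite /unit_weight max_r; last by rewrite mulr_ge0// ltW.
  by rewrite -/z mulrAC divff ?mul1r// lt0r_neq0.
Qed.

End environment.

(** * The flux *)

Section scaled_point.
Context {R : realType} (x y : R) (n : nat).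
Hypotheses (y0 : 0 <= y) (xy0 : 0 <= x + y).

Definition scaled_m : nat := absz ((scaled_pt x y n).1 + (scaled_pt x y n).2).
Definition scaled_j : nat := absz (scaled_pt x y n).2.

Lemma scaled_floor_ge0 : 0 <= Num.floor (y * n%:R).
Proof. by rewrite floor_ge0 mulr_ge0. Qed.

Lemma scaled_ptE : scaled_pt x y n = site scaled_m scaled_j.
Proof.
have j0 := scaled_floor_ge0.
rewrite /site /scaled_m /scaled_j /scaled_pt /=.
rewrite !gez0_abs ?addrK//.
by rewrite -lerBlDr sub0r le_max lexx orbT.
Qed.

Lemma scaled_j_bounds : scaled_j%:R <= y * n%:R < scaled_j%:R + 1.
Proof.
have j0 := scaled_floor_ge0.
have := floor_itv (y * n%:R); rewrite intrD /=.
by rewrite -[in X in X -> _](gez0_abs j0).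
Qed.

(** When the rounded point is pushed into the quadrant, [0 <= x + y] keeps the displacement within
    the same error of one. *)
Lemma scaled_m_bounds :
  `|scaled_m%:R - scaled_j%:R - x * n%:R| <= 1.
Proof.
have j0 := scaled_floor_ge0; have /andP[h1 h2] := scaled_j_bounds.
have xyn : 0 <= x * n%:R + y * n%:R by rewrite -mulrDl mulr_ge0.
have mE : (scaled_m%:R - scaled_j%:R : R) = ((scaled_pt x y n).1)%:~R.
  have -> : (scaled_pt x y n).1 = scaled_m%:Z - scaled_j%:Z.
    by rewrite {1}scaled_ptE.
  by rewrite intrB.
have jE : (scaled_j%:R : R) = (Num.floor (y * n%:R))%:~R.
  by rewrite -[in RHS](gez0_abs j0).
rewrite mE /scaled_pt /=; move: h1 h2; rewrite jE.
have /andP[h3 h4] := floor_itv (x * n%:R); move: h4; rewrite intrD => h4 h1 h2.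
rewrite ler_norml; set u := Num.floor (x * n%:R) in h3 h4 *; set v := Num.floor _ in h1 h2 *.
have [uv|vu] := leP u (- v); last by apply/andP; split; lra.
have : (u%:~R : R) <= (- v)%:~R by rewrite ler_int.
rewrite intrN => uv'; apply/andP; split; lra.
Qed.

End scaled_point.

Lemma columns_cstB {R : realType} (c : R) (e : int -> R) m n :
  columns (fun z => c - e z) m n = c * ((m - n) + (n - m))%:R - columns e m n.
Proof.
have H p (g : 'I_p -> R) : \sum_(k < p) (c - g k) = c * p%:R - \sum_(k < p) g k.
  by rewrite sumrB sumr_const card_ord mulr_natr.
by rewrite /columns !H natrD; ring.
Qed.

Lemma ge0_integral_addC {R : realType} {d} {T : measurableType d} (P : probability T R)
    (g : T -> R) (k : R) : measurable_fun setT g -> (forall w, 0 <= g w) -> 0 <= k ->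
  (\int[P]_w (g w + k)%:E = \int[P]_w (g w)%:E + k%:E)%E.
Proof.
move=> mg g0 k0; under eq_integral do rewrite EFinD.
rewrite ge0_integralD//.
- by rewrite integral_cst// [X in (_ + _ * X)%E]probability_setT mule1.
- by move=> w _; rewrite lee_fin.
- exact/measurable_EFinP.
Qed.

Section flux.
Context {R : realType} {d : measure_display} {Omega : measurableType d}
  (P : probability Omega R) (alpha : int -> {RV P >-> R})
  (alpha_pos : forall i w, 0 < alpha i w)
  (alpha_indep : mutually_independent P (fun i => (alpha i : Omega -> R)))
  (alpha_ident : forall i, same_law P (alpha i) (alpha 0)).
Variables (r mu : R).
Hypotheses (r_def : r = inf [set s : R | (P [set w | (s <= alpha 0 w)%R] < 1)%E])
  (r_pos : 0 < r)
  (mu_def : mu%:E = (r^-1%:E - 'E_P[fun w => ((alpha 0%R w)^-1)%R])%E).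
Context {d' : measure_display} {Xi : measurableType d'}
  (Q : (int -> R) -> probability Xi R)
  (Y : (int -> R) -> int -> int -> Xi -> R)
  (Y_law : forall a : int -> R, (forall i, 0 < a i) ->
     (forall i j, measurable_fun setT (Y a i j)) /\
     mutually_independent (Q a) (fun p : int * int => Y a p.1 p.2) /\
     (forall i j, exp_law (Q a) (a i) (Y a i j)))
  (tau : R -> R -> R)
  (tau_def : forall x y : R, 0 <= y -> 0 <= x + y ->
     {ae P, forall w, {ae Q (fun i => alpha i w), forall xi,
        (fun n : nat => n%:R^-1 * lpp_T (fun i j => Y (fun i => alpha i w) i j xi)
                                          (scaled_pt x y n))
          @ \oo --> tau x y}}).

Let E := [set s : R | (P [set w | (s <= alpha 0 w)%R] < 1)%E].

Let mge s : measurable [set w | (s <= alpha 0 w)%R].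
Proof.
have -> : [set w | (s <= alpha 0 w)%R] = alpha 0 @^-1` `[s, +oo[%classic.
  by apply/seteqP; split => w /=; rewrite in_itv/= andbT.
by rewrite -[X in measurable X]setTI; exact: measurable_funP.
Qed.

Let Elb : lbound E 0.
Proof.
move=> s Es; rewrite leNgt; apply/negP => s0.
have sT : [set w | (s <= alpha 0 w)%R] = setT.
  by apply/seteqP; split => // w _ /=; rewrite (le_trans (ltW s0))// ltW.
by move: Es; rewrite /E /= sT probability_setT ltxx.
Qed.

Let E_has_inf : has_inf E.
Proof.
split; last by exists 0.
(* The infimum of the empty set is 0 by convention, which [0 < r] excludes. *)
apply/set0P/negP => /eqP E0; move: r_pos.
by rewrite r_def -/E E0 inf0 ltxx.
Qed.

Lemma alpha_ge_ess_inf : {ae P, forall w, forall i, r <= alpha i w}.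
Proof.
have H0 s : s < r -> P (alpha 0 @^-1` `]-oo, s[%classic) = 0%E.
  move=> sr.
  have -> : alpha 0 @^-1` `]-oo, s[%classic = ~` [set w | (s <= alpha 0 w)%R].
    by apply/seteqP; split => w /=; rewrite in_itv/= ltNge => /negP.
  rewrite probability_setC//.
  suff -> : P [set w | (s <= alpha 0 w)%R] = 1%E by rewrite subee.
  apply/eqP; rewrite eq_le probability_le1//= leNgt; apply/negP => Es.
  have := ge_inf (ex_intro _ 0 Elb) (Es : E s).
  by rewrite -r_def leNgt sr.
have H i : {ae P, forall w, r <= alpha i w}.
  have H1 (k : nat) : {ae P, forall w, r - k.+1%:R^-1 <= alpha i w}.
    exists (alpha i @^-1` `]-oo, r - k.+1%:R^-1[%classic); split.
    - by rewrite -[X in measurable X]setTI; exact: measurable_funP.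
    - by rewrite alpha_ident// H0// ltrBlDr ltrDl invr_gt0.
    - by move=> w /=; rewrite in_itv/= => /negP; rewrite -ltNge.
  have := ae_foralln H1; apply: filterS => w Hw.
  rewrite leNgt; apply/negP => wr.
  have := Hw (Num.truncn ((r - alpha i w)^-1)).
  rewrite leNgt => /negP; apply.
  rewrite ltrBrDl -ltrBrDr -[ltRHS]invrK ltf_pV2 ?posrE ?invr_gt0 ?subr_gt0//.
  exact: truncnS_gt.
have Hp : {ae P, forall w, forall n : nat, r <= alpha (Posz n) w}.
  by apply: ae_foralln => n; exact: H.
have Hn : {ae P, forall w, forall n : nat, r <= alpha (Negz n) w}.
  by apply: ae_foralln => n; exact: H.
by apply: ae_mono2 Hp Hn => w wp wn [].
Qed.

Lemma alpha_near_ess_inf eps : 0 < eps ->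
  (0 < P (alpha 0 @^-1` `]-oo, (r + eps)%R[%classic))%E.
Proof.
move=> e0; have [s Es sr] := inf_adherent e0 E_has_inf.
rewrite -r_def in sr.
apply: (@lt_le_trans _ _ (P (~` [set w | (s <= alpha 0 w)%R]))).
  by rewrite probability_setC// sube_gt0.
apply: le_measure.
- exact/mem_set/measurableC.
- by apply/mem_set; rewrite -[X in measurable X]setTI; exact: measurable_funP.
- by move=> w /= /negP; rewrite -ltNge in_itv/= => /lt_trans; exact.
Qed.

Lemma slow_stretch_gt0 eps (s : seq int) : 0 < eps -> uniq s ->
  (0 < P (\bigcap_(i in [set` seq_fset tt s]) (alpha i @^-1` `]-oo, (r + eps)%R[%classic)))%E.
Proof.
move=> e0 us.
rewrite (alpha_indep (seq_fset tt s) (fun=> `]-oo, (r + eps)%R[%classic))//.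
rewrite big_seq; elim/big_rec: _ => // i z _ z0.
by rewrite mule_gt0// alpha_ident// alpha_near_ess_inf.
Qed.

Lemma measurable_inv_alpha i : measurable_fun setT (fun w => (alpha i w)^-1).
Proof.
rewrite (_ : (fun w => _) = (fun w => powR (alpha i w) (-1))); last first.
  by apply/funext => w; rewrite powR_inv1// ltW.
by apply: (measurableT_comp (measurable_powR _)); exact: measurable_funP.
Qed.

Lemma integral_inv_alpha i : (\int[P]_w ((alpha i w)^-1)%:E = (r^-1 - mu)%:E)%E.
Proof.
have -> : (\int[P]_w ((alpha i w)^-1)%:E = \int[P]_w ((alpha 0 w)^-1)%:E)%E.
  have m0 : measurable_fun setT (alpha 0) by exact: measurable_funP.
  have mi : measurable_fun setT (alpha i) by exact: measurable_funP.
  have mf : measurable_fun setT (fun x : R => (powR x (-1))%:E).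
    by apply/measurable_EFinP; exact: measurable_powR.
  have pE j w : (alpha j w)^-1 = powR (alpha j w) (-1) by rewrite powR_inv1// ltW.
  under eq_integral do rewrite pE.
  under [RHS]eq_integral do rewrite pE.
  have f0 (x : R) : (0 <= (powR x (-1))%:E)%E by rewrite lee_fin powR_ge0.
  rewrite (ge0_integral_law P (image_law P m0) (alpha i) _ mi _ mf f0)//; last first.
    by move=> B mB; exact: alpha_ident.
  by rewrite -(ge0_integral_law P (image_law P m0) (alpha 0) _ m0 _ mf f0).
(* As [mu] is a real number, the expectation of the inverse rate must be finite. *)
move: mu_def; rewrite unlock.
case: (\int[P]_w _)%E => [z| |] //; rewrite -EFinB => -[->].
by congr EFin; ring.
Qed.

Let env w : int -> R := fun i => alpha i w.

Let f (x y : R) (w : Omega) (n : nat) (xi : Xi) : R := n%:R^-1 *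
  lpp (fun i j => unit_weight (env w) (Y (env w)) i j xi / env w (i%:Z - j%:Z))
    (scaled_j x y n) (scaled_m x y n).

Lemma ae_lpp_cvg x y : 0 <= y -> 0 <= x + y ->
  {ae P, forall w, {ae Q (env w), forall xi, f x y w n xi @[n --> \oo] --> tau x y}}.
Proof.
move=> y0 xy0; have := tau_def x y y0 xy0; apply: filterS => w Hw.
have aw0 i : 0 < env w i by exact: alpha_pos.
have [mY [iY lY]] := Y_law (env w) aw0.
have Hu := ae_unit_weight (Q (env w)) (env w) (Y (env w)) aw0 mY lY.
apply: ae_mono2 Hw Hu => xi Hxi Hu.
rewrite (_ : (fun n => f x y w n xi) = (fun n : nat => n%:R^-1 * lpp_T (fun i j => Y (env w) i j xi)
                                          (scaled_pt x y n)))//.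
apply/funext => n; rewrite /f (scaled_ptE x y n y0) lpp_TE; congr (_ * _).
by apply: eq_lpp => i j _ _; rewrite -Hu.
Qed.

Let mf x y w n : measurable_fun setT (f x y w n).
Proof.
have aw0 i : 0 < env w i by exact: alpha_pos.
have [mY _] := Y_law (env w) aw0.
apply: measurable_funM => //; apply: measurable_lpp => i j.
by apply: measurable_funM => //; exact: measurable_unit_weight.
Qed.

Let f0 x y w n xi : 0 <= f x y w n xi.
Proof.
rewrite mulr_ge0 ?invr_ge0// lpp_ge0// => i j; rewrite divr_ge0 ?unit_weight_ge0//.
exact/ltW/alpha_pos.
Qed.

Let ae_exists (A : Omega -> Prop) : {ae P, forall w, A w} -> exists w, A w.
Proof.
move=> HA; have [|w Aw _] := ae_ex P A setT measurableT _ HA; last by exists w.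
by rewrite probability_setT.
Qed.

Lemma tau_ge0 x y : 0 <= y -> 0 <= x + y -> 0 <= tau x y.
Proof.
move=> y0 xy0; have [w Hw] := ae_exists _ (ae_lpp_cvg x y y0 xy0).
have := cvg_integral_min (Q (env w)) _ _ `|tau x y| (mf x y w) (f0 x y w) (normr_ge0 _) Hw.
rewrite min_l ?ler_norm// => H.
apply: (cvg_ge_of_rate _ _ _ 0 H) => n n0.
by rewrite mul0r subr0 integral_ge0// => xi _; rewrite lee_fin le_min f0 normr_ge0.
Qed.

Lemma integral_f_le x y w n : (forall i, r <= alpha i w) ->
  (\int[Q (env w)]_xi (f x y w n xi)%:E <=
   (n%:R^-1 * ((2 * (scaled_j x y n + scaled_m x y n)%:R + 1) / r -
     columns (fun z => r^-1 - (alpha z w)^-1) (scaled_m x y n) (scaled_j x y n)))%:E)%E.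
Proof.
move=> rw; have aw0 i : 0 < env w i by exact: alpha_pos.
have [mY [iY lY]] := Y_law (env w) aw0.
have := integral_lpp_disorder_le (Q (env w)) (unit_weight (env w) (Y (env w)))
  (measurable_unit_weight _ _ mY) (unit_weight_ge0 _ _)
  (joint_law_unit_weight (Q (env w)) (env w) (Y (env w)) aw0 iY lY)
  (env w) r (scaled_j x y n) (scaled_m x y n) r_pos rw.
rewrite -leeBrDr// -EFinB => H.
under eq_integral do rewrite EFinM.
rewrite ge0_integralZl//; last 2 first.
- apply/measurable_EFinP; apply: measurable_lpp => i j.
  by apply: measurable_funM => //; exact: measurable_unit_weight.
- move=> xi _; rewrite lee_fin lpp_ge0// => i j.
  by rewrite divr_ge0 ?unit_weight_ge0// ltW.
rewrite EFinM; apply: lee_pmul => //.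
apply: integral_ge0 => xi _; rewrite lee_fin lpp_ge0// => i j.
by rewrite divr_ge0 ?unit_weight_ge0// ltW.
Qed.

Let bd (x y : R) (n : nat) (w : Omega) : R := n%:R^-1 * ((2 * (scaled_j x y n + scaled_m x y n)%:R + 1) / r -
     columns (fun z => r^-1 - (alpha z w)^-1) (scaled_m x y n) (scaled_j x y n)).

(** [bd] is the quenched bound on the mean of [f], hence nonnegative when all rates are at least
    [r], which is almost sure; the positive part makes it so everywhere. *)
Let c (x y : R) (n : nat) (w : Omega) : R := Num.max 0 (bd x y n w).

Lemma measurable_columns (e : int -> Omega -> R) m n : (forall z, measurable_fun setT (e z)) ->
  measurable_fun setT (fun w => columns (e ^~ w) m n).
Proof. by move=> me; apply: measurable_funD; apply: measurable_sum => k; exact: me. Qed.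

Let mc x y n : measurable_fun setT (c x y n).
Proof.
apply: measurable_maxr => //; apply: measurable_funM => //; apply: measurable_funB => //.
apply: (measurable_columns (fun z w => r^-1 - (alpha z w)^-1)) => z.
by apply: measurable_funB => //; exact: measurable_inv_alpha.
Qed.

Lemma integral_columns_inv m n :
  (\int[P]_w (columns (fun z => (alpha z w)^-1) m n)%:E =
   (((m - n) + (n - m))%:R * (r^-1 - mu))%:E)%E.
Proof.
have inv0 z w : 0 <= (alpha z w)^-1 by rewrite invr_ge0 ltW.
have S p (g : 'I_p -> int) : (\sum_(k < p) \int[P]_w ((alpha (g k) w)^-1)%:E =
    (p%:R * (r^-1 - mu))%:E)%E.
  rewrite (eq_bigr (fun=> (r^-1 - mu)%:E)); last by move=> k _; exact: integral_inv_alpha.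
  by rewrite sumEFin sumr_const card_ord mulr_natl.
rewrite /columns; under eq_integral do rewrite EFinD.
rewrite ge0_integralD//.
- rewrite !ge0_integral_sum_ord//; try by move=> k; exact: measurable_inv_alpha.
  rewrite [X in (X + _)%E](S _ (fun k => k.+1%:Z)) [X in (_ + X)%E](S _ (fun k => - k.+1%:Z)).
  by rewrite -EFinD natrD mulrDl.
- by move=> w _; rewrite lee_fin sumr_ge0.
- by apply/measurable_EFinP; apply: measurable_sum => k; exact: measurable_inv_alpha.
- by move=> w _; rewrite lee_fin sumr_ge0.
- by apply/measurable_EFinP; apply: measurable_sum => k; exact: measurable_inv_alpha.
Qed.

Lemma integral_c_le x y n : 0 <= y -> 0 <= x + y -> (0 < n)%N ->
  (\int[P]_w (c x y n w)%:E <=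
    (2 * (x + 2 * y) / r - mu * `|x| + (3 / r + `|mu|) / n%:R)%:E)%E.
Proof.
move=> y0 xy0 n0.
set j := scaled_j x y n; set m := scaled_m x y n.
have n0' : 0 < n%:R :> R by rewrite ltr0n.
pose D : R := ((m - j) + (j - m))%:R.
pose K : R := n%:R^-1 * ((2 * (j + m)%:R + 1) / r).
have D0 : 0 <= D by rewrite ler0n.
(* The subtracted terms are moved across so that both sides are integrals of nonnegative functions;
   [D] is the number of columns counted. *)
have key : (\int[P]_w (c x y n w)%:E + (n%:R^-1 * (r^-1 * D))%:E =
    K%:E + (n%:R^-1)%:E * (D * (r^-1 - mu))%:E)%E.
  have inv0 z w : 0 <= (alpha z w)^-1 by rewrite invr_ge0 ltW.
  have mcol : measurable_fun setT (fun w => columns (fun z => (alpha z w)^-1) m j).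
    by apply: (measurable_columns (fun z w => (alpha z w)^-1)) => z; exact: measurable_inv_alpha.
  have col0 w : 0 <= columns (fun z => (alpha z w)^-1) m j.
    by rewrite addr_ge0// sumr_ge0.
  have K0 : 0 <= K by rewrite mulr_ge0 ?invr_ge0// divr_ge0 ?(ltW r_pos)// addr_ge0.
  have nD0 : 0 <= n%:R^-1 * (r^-1 * D) by rewrite !mulr_ge0 ?invr_ge0// ltW.
  have n00 : 0 <= n%:R^-1 :> R by rewrite invr_ge0.
  have c00 w : 0 <= c x y n w by rewrite le_max lexx.
  have mn : measurable_fun setT
      (fun w => n%:R^-1 * columns (fun z => (alpha z w)^-1) m j).
    exact: measurable_funM.
  rewrite /D -integral_columns_inv -/D -ge0_integralZl//; last 2 first.
    exact/measurable_EFinP.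
    by move=> w _; rewrite lee_fin.
  under [in RHS]eq_integral do rewrite -EFinM.
  rewrite [RHS]addeC -!ge0_integral_addC//; last by move=> w; exact: mulr_ge0.
  apply: ae_eq_integral => //.
  - by apply/measurable_EFinP; exact: measurable_funD.
  - by apply/measurable_EFinP; exact: measurable_funD.
  - apply: filterS alpha_ge_ess_inf => w rw _; congr EFin.
    have b0 : 0 <= bd x y n w.
      rewrite -lee_fin; apply: le_trans (integral_f_le x y w n rw).
      by apply: integral_ge0 => xi _; rewrite lee_fin.
    rewrite /c max_r// /bd -/j -/m columns_cstB -/D /K; ring.
(* Rounding changes [m] by at most one, which with the corner term gives [3 / r]; it changes [D] by
   at most one, which gives the absolute value of [mu]. *)
have cmp : n%:R^-1 * (r^-1 * D) + (2 * (x + 2 * y) / r - mu * `|x| + (3 / r + `|mu|) / n%:R)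
   >= K + n%:R^-1 * (D * (r^-1 - mu)).
  set v := n%:R^-1.
  have v0 : 0 < v by rewrite invr_gt0.
  have nv : n%:R * v = 1 by rewrite divff// lt0r_neq0.
  have mb : (`|m%:R - j%:R - x * n%:R| <= 1) by exact: scaled_m_bounds.
  have /andP[j1 _] : j%:R <= y * n%:R < j%:R + 1 by exact: scaled_j_bounds.
  have DE : D = `|m%:R - j%:R|.
    rewrite /D; have [jm|mj] := leqP j m.
      rewrite (_ : (j - m)%N = 0%N) ?addn0 ?natrB// ?ger0_norm ?subr_ge0 ?ler_nat//.
      by apply/eqP; rewrite subn_eq0.
    rewrite (_ : (m - j)%N = 0%N) ?add0n; last by apply/eqP; rewrite subn_eq0 ltnW.
    by rewrite natrB ?(ltnW mj)// distrC ger0_norm// subr_ge0 ler_nat ltnW.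
  have Dx : (`| `|x| * n%:R - D| <= 1).
    rewrite DE -[X in _ * X](ger0_norm (ltW n0')) -normrM distrC.
    exact: le_trans (ler_dist_dist _ _) mb.
  have hmu : mu * (`|x| * n%:R - D) <= `|mu|.
    rewrite (le_trans (ler_norm _))// normrM -[leRHS]mulr1.
    exact: ler_wpM2l.
  have hK : (2 * (j + m)%:R + 1) / r <= (2 * (x + 2 * y) * n%:R + 3) / r.
    rewrite ler_pM2r ?invr_gt0// natrD.
    by move: mb; rewrite ler_norml => /andP[_ mb]; lra.
  have vK := ler_wpM2l (ltW v0) hK; have vmu := ler_wpM2l (ltW v0) hmu.
  have e1 : v * ((2 * (x + 2 * y) * n%:R + 3) / r) = 2 * (x + 2 * y) / r + 3 / r * v.
    transitivity (2 * (x + 2 * y) / r * (n%:R * v) + 3 / r * v); first by ring.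
    by rewrite nv mulr1.
  have e2 : v * (mu * (`|x| * n%:R - D)) = mu * `|x| - v * (mu * D).
    transitivity (mu * `|x| * (n%:R * v) - v * (mu * D)); first by ring.
    by rewrite nv mulr1.
  rewrite e1 in vK; rewrite e2 in vmu; rewrite /K -/v.
  rewrite -subr_ge0 in vK; rewrite -subr_ge0 in vmu; rewrite -subr_ge0.
  apply: (le_trans (addr_ge0 vK vmu)); rewrite le_eqVlt; apply/orP; left; apply/eqP.
  ring.
move: key; case: (\int[P]_w _)%E => [z| |] //.
rewrite -EFinM -!EFinD => -[key]; rewrite lee_fin; lra.
Qed.

(** For almost every environment, [min (c n) K] with [K = tau x y] lies between the quenched mean of
    the truncated passage time, which tends to [K], and [K] itself. Its mean therefore tends to [K]
    too, while it stays below the averaged bound. *)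
Lemma tau_le x y : 0 <= y -> 0 <= x + y ->
  tau x y <= 2 * (x + 2 * y) / r - mu * `|x|.
Proof.
move=> y0 xy0; pose K := tau x y.
have K0 : 0 <= K by exact: tau_ge0.
have c0 n w : 0 <= Num.min (c x y n w) K by rewrite le_min le_max lexx.
have mcK n : measurable_fun setT (fun w => Num.min (c x y n w) K).
  exact: measurable_minr.
have ccvg : {ae P, forall w, Num.min (c x y n w) K @[n --> \oo] --> K}.
  apply: ae_mono2 (ae_lpp_cvg x y y0 xy0) alpha_ge_ess_inf => w Hw rw.
  have u := cvg_integral_min (Q (env w)) _ _ K (mf x y w) (f0 x y w) K0 Hw.
  rewrite minxx in u.
  have : (Num.min (c x y n w) K)%:E @[n --> \oo] --> K%:E.
    apply: squeeze_cvge u (cvg_cst K%:E); apply: nearW => n.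
    apply/andP; split; last by rewrite lee_fin ge_min lexx orbT.
    rewrite EFin_min le_min; apply/andP; split.
      apply: (@le_trans _ _ (bd x y n w)%:E); last by rewrite lee_fin le_max lexx orbT.
      apply: le_trans (integral_f_le x y w n rw).
      apply: ge0_le_integral => //.
      - by move=> xi _; rewrite lee_fin le_min f0.
      - by apply/measurable_EFinP; exact: measurable_minr.
      - exact/measurable_EFinP.
      - by move=> xi _; rewrite lee_fin ge_min lexx.
    rewrite -[leRHS]mule1 -(@probability_setT _ _ _ (Q (env w))) -integral_cst//.
    apply: ge0_le_integral => //.
    - by move=> xi _; rewrite lee_fin le_min f0.
    - by apply/measurable_EFinP; exact: measurable_minr.
    - by move=> xi _; rewrite lee_fin ge_min lexx orbT.
  by move=> /fine_cvgP[_].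
have := cvg_integral_min P _ K K mcK c0 K0 ccvg.
rewrite minxx => H.
apply: (cvg_le_of_rate _ _ _ (3 / r + `|mu|) H) => n n0.
apply: le_trans (integral_c_le x y n y0 xy0 n0).
apply: ge0_le_integral => //.
- by move=> w _; rewrite lee_fin le_min c0.
- by apply/measurable_EFinP; exact: measurable_minr.
- exact/measurable_EFinP.
- by move=> w _; rewrite lee_fin !ge_min lexx.
Qed.

Lemma tau_ge eps y : 0 < eps -> eps < 4 -> 0 <= y ->
  y * (4 - eps) / (r + eps) <= tau 0 y.
Proof.
move=> e0 e4 y0.
have y0' : 0 <= 0 + y by rewrite add0r.
have [N [C [C0 HN]]] := lpp_diag_lower_bound eps e0.
(* The columns met by a diagonal block of side [N.+1]; one environment slow on all of them, and for
   which the limit holds, is fixed. *)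
pose s : seq int := [seq (i%:Z - j%:Z) | i <- iota 0 N.+1, j <- iota 0 N.+1].
have mB : measurable (\bigcap_(i in [set` seq_fset tt (undup s)]) (alpha i @^-1` `]-oo, (r + eps)%R[%classic)).
  apply: fin_bigcap_measurable => // i _.
  by rewrite -[X in measurable X]setTI; exact: measurable_funP.
have [w Hw Hs] := ae_ex P _ _ mB (slow_stretch_gt0 eps _ e0 (undup_uniq s))
  (ae_lpp_cvg 0 y y0 y0').
have slow i j : (i <= N)%N -> (j <= N)%N -> alpha (i%:Z - j%:Z) w < r + eps.
  move=> iN jN.
  have zs : i%:Z - j%:Z \in seq_fset tt (undup s).
    rewrite seq_fsetE mem_undup; apply/allpairsP; exists (i, j).
    by split => //; rewrite mem_iota add0n ltnS.
  by have := Hs _ zs; rewrite /= in_itv/=.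
have aw0 i : 0 < env w i by exact: alpha_pos.
have [mY [iY lY]] := Y_law (env w) aw0.
set X := unit_weight (env w) (Y (env w)).
have mX : forall i j, measurable_fun setT (X i j) by exact: measurable_unit_weight.
have X0 i j xi : 0 <= X i j xi by exact: unit_weight_ge0.
have lX := joint_law_unit_weight (Q (env w)) (env w) (Y (env w)) aw0 iY lY.
have re0 : 0 < r + eps by rewrite addr_gt0.
(* The [q] blocks, truncated at [C], add up to at most [q * C] with [q <= y * n], so after scaling
   their sum is not affected by truncation at [K]. *)
pose K := y * C / (r + eps).
have K0 : 0 <= K by rewrite divr_ge0 ?(ltW re0)// mulr_ge0// ltW.
have u := cvg_integral_min (Q (env w)) _ _ K (mf 0 y w) (f0 0 y w) K0 Hw.
apply: (@le_trans _ _ (Num.min (tau 0 y) K)); last by rewrite ge_min lexx.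
(* The error term pays for the rounding of [y * n] and for the incomplete last block. *)
apply: (cvg_ge_of_rate _ _ _ ((4 - eps) * N.+2%:R / (r + eps)) u) => n n0.
have n0' : 0 < n%:R :> R by rewrite ltr0n.
have mE : scaled_m 0 y n = scaled_j 0 y n.
  have := scaled_m_bounds 0 y n y0 y0'; have := scaled_j_bounds 0 y n y0.
  rewrite /scaled_m /scaled_j /scaled_pt /= mul0r floor0.
  have := scaled_floor_ge0 y n y0; set v := Num.floor _ => v0 _ _.
  by rewrite max_l ?add0r// oppr_le0.
set k := scaled_j 0 y n; pose q := (k %/ N.+1)%N.
have qk : (q * N.+1 <= k)%N by exact: leq_trunc_div.
have qk' : (k < (q.+1) * N.+1)%N by rewrite -ltn_divLR.
have /andP[k1 k2] := scaled_j_bounds 0 y n y0.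
have qy : q%:R <= y * n%:R.
  apply: le_trans k1; rewrite ler_nat (leq_trans _ qk)//; exact: leq_pmulr.
pose g (b : 'I_q) xi := lpp (fun i j => X (b * N.+1 + i)%N (b * N.+1 + j)%N xi) N N.
pose t := n%:R^-1 / (r + eps).
have t0 : 0 <= t by rewrite divr_ge0 ?invr_ge0// ltW.
have mg b : measurable_fun setT (g b) by exact: measurable_lpp.
have g0 b xi : 0 <= g b xi by exact: lpp_ge0.
have pw xi : t * \sum_(b < q) Num.min (g b xi) C <= Num.min (f 0 y w n xi) K.
  rewrite le_min; apply/andP; split.
    rewrite /t /f mE -/k -mulrA ler_wpM2l ?invr_ge0//.
    apply: le_trans (lpp_blocks _ N q k _ _); last 2 first.
    - by move=> i j; rewrite divr_ge0 ?X0// ltW.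
    - exact: leqW.
    rewrite mulr_sumr; apply: ler_sum => b _.
    apply: (@le_trans _ _ ((r + eps)^-1 * g b xi)).
      by rewrite ler_wpM2l ?invr_ge0 ?(ltW re0)// ge_min lexx.
    rewrite /g -lppZ ?invr_ge0 ?(ltW re0)//; apply: le_lpp => i j iN jN.
    rewrite mulrC ler_wpM2l ?X0// lef_pV2 ?posrE//.
    by rewrite !PoszD opprD addrACA subrr add0r; exact/ltW/slow.
  apply: (@le_trans _ _ (t * (q%:R * C))).
    rewrite ler_wpM2l//; apply: (le_trans (sum_min_le q (fun b => g b xi) C)).
    by rewrite ge_min lexx orbT.
  have qn : q%:R / n%:R <= y by rewrite ler_pdivrMr.
  rewrite (_ : t * _ = q%:R / n%:R * (C / (r + eps))); last by rewrite /t; ring.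
  rewrite /K (_ : y * C / (r + eps) = y * (C / (r + eps))) ; last by rewrite mulrA.
  by apply: ler_wpM2r qn; rewrite divr_ge0// ltW.
have EL : ((t * (q%:R * ((4 - eps) * N.+1%:R)))%:E <=
    \int[Q (env w)]_xi (Num.min (f 0 y w n xi) K)%:E)%E.
  apply: (@le_trans _ _ (\int[Q (env w)]_xi (t * \sum_(b < q) Num.min (g b xi) C)%:E)%E); last first.
    apply: ge0_le_integral => //.
    - move=> xi _; rewrite lee_fin mulr_ge0// sumr_ge0// => b _.
      by rewrite le_min g0 ltW.
    - apply/measurable_EFinP; apply: measurable_funM => //; apply: measurable_sum => b.
      exact: measurable_minr.
    - by apply/measurable_EFinP; exact: measurable_minr.
    - by move=> xi _; rewrite lee_fin.
  under eq_integral do rewrite EFinM.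
  rewrite ge0_integralZl//; last 2 first.
    apply/measurable_EFinP; apply: measurable_sum => b; exact: measurable_minr.
    by move=> xi _; rewrite lee_fin sumr_ge0// => b _; rewrite le_min g0 ltW.
  rewrite EFinM; apply: lee_pmul => //.
    by rewrite lee_fin !mulr_ge0// subr_ge0 ltW.
  rewrite ge0_integral_sum_ord; last 2 first.
    by move=> b; exact: measurable_minr.
    by move=> b xi; rewrite le_min g0 ltW.
  have -> : (q%:R * ((4 - eps) * N.+1%:R))%:E = (\sum_(b < q) ((4 - eps) * N.+1%:R)%:E)%E.
    by rewrite sumEFin sumr_const card_ord mulr_natl.
  apply: lee_sum => b _.
  apply: (HN _ _ (Q (env w)) (fun i j => X (b * N.+1 + i)%N (b * N.+1 + j)%N)) => //.
  pose sh (p : nat * nat) := ((b * N.+1 + p.1)%N, (b * N.+1 + p.2)%N).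
  pose hs (p : nat * nat) := ((p.1 - b * N.+1)%N, (p.2 - b * N.+1)%N).
  have shK : cancel sh hs by move=> [i j]; rewrite /hs /sh /= !addKn.
  exact: (joint_law_inj (Q (env w)) _ _ sh hs shK lX).
apply: le_trans EL; rewrite lee_fin.
have qD : y * n%:R <= q%:R * N.+1%:R + N.+1%:R.
  rewrite (le_trans (ltW k2))// -natrM -natrD natr1 ler_nat.
  by rewrite (leq_trans qk')// mulSn addnC.
have c0 : 0 <= (4 - eps) / (r + eps) by rewrite divr_ge0// ?(ltW re0)// subr_ge0 ltW.
rewrite (_ : t * _ = (4 - eps) / (r + eps) * (q%:R * N.+1%:R / n%:R)); last by rewrite /t; ring.
rewrite (_ : _ - _ = (4 - eps) / (r + eps) * (y - N.+2%:R / n%:R)); last by ring.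
apply: ler_wpM2l => //.
rewrite -(ler_pM2r n0') mulrBl !divfK ?lt0r_neq0// -[N.+2%:R]natr1; lra.
Qed.

Lemma flux_eq rho : 1/2 - mu * r / 4 <= rho <= 1/2 + mu * r / 4 ->
  flux tau rho = (r / 4)%:E.
Proof.
move=> /andP[rho1 rho2]; apply/eqP; rewrite eq_le; apply/andP; split.
  apply: (@le_trans _ _ (k_of tau 0 + (0 * rho)%:E)%E).
    by apply: ereal_inf_lbound; exists 0.
  rewrite mul0r adde0; apply/lee_addgt0Pr => e e0.
  apply: ereal_inf_lbound; exists (r / 4 + e); last by rewrite EFinD.
  set y := r / 4 + e.
  have y0 : 0 <= y by rewrite addr_ge0 ?(ltW e0)// divr_ge0// ltW.
  have e4 : 0 < 4 * y - r by rewrite /y; lra.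
  split; first exact: y0.
  split; first by rewrite add0r.
  clearbody y; have y1 : 0 < 2 * (y + 1) by lra.
  (* The required [r + eps < y * (4 - eps)] amounts to [eps * (y + 1) < 4 * y - r]; this [eps] makes
     the left side half of the right one. *)
  have [eps [eps0 eps4 epsE]] : exists eps : R,
      [/\ 0 < eps, eps < 4 & eps * (2 * (y + 1)) = 4 * y - r].
    exists ((4 * y - r) / (2 * (y + 1))).
    by rewrite divr_gt0// ltr_pdivrMr// divfK ?lt0r_neq0//; split => //; move: (r_pos); lra.
  apply: (lt_le_trans _ (tau_ge eps y eps0 eps4 y0)).
  by rewrite ltr_pdivlMr ?addr_gt0// mul1r; lra.
apply: le_ereal_inf_tmp => _ [v _ <-].
rewrite -leeBlDr// -EFinB.
apply: le_ereal_inf_tmp => _ [y [y0 [vy0 t1]] <-].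
rewrite lee_fin.
have tr : r * tau v y <= 2 * (v + 2 * y) - mu * `|v| * r.
  apply: (le_trans (ler_wpM2l (ltW r_pos) (tau_le v y y0 vy0))).
  by rewrite mulrBr mulrCA divff ?lt0r_neq0// mulr1 [r * _]mulrC.
have rt : r < r * tau v y by rewrite ltr_pMr.
(* The lower end of the range of [rho] serves [v >= 0], the upper end [v < 0]; the bound cancels the
   [v]-dependent terms left by [tau_le]. *)
have vrho : v / 2 - mu * r * `|v| / 4 <= v * rho.
  have [v0|v0] := leP 0 v.
    by rewrite ger0_norm//; have := ler_wpM2l v0 rho1; lra.
  by rewrite ltr0_norm//; have := ler_wnM2l (ltW v0) rho2; lra.
lra.
Qed.

End flux.

Theorem mainTheorem1
  (R : realType)
  (* the disorder: i.i.d. positive, non-degenerate random variables alpha(i) *)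
  (d : measure_display) (Omega : measurableType d) (P : probability Omega R)
  (alpha : int -> {RV P >-> R})
  (alpha_pos : forall i w, 0 < alpha i w)
  (alpha_indep : mutually_independent P (fun i => (alpha i : Omega -> R)))
  (alpha_ident : forall i, same_law P (alpha i) (alpha 0))
  (alpha_nondeg : ~ (exists c : R, P (alpha 0 @^-1` [set c]) = 1%E))
  (* r = essential infimum, assumed > 0 *)
  (r : R) (r_def : r = inf [set s : R | (P [set w | (s <= alpha 0 w)%R] < 1)%E])
  (r_pos : 0 < r)
  (* mu = 1/r - E[1/alpha(i)] *)
  (mu : R) (mu_def : mu%:E = (r^-1%:E - 'E_P[fun w => ((alpha 0%R w)^-1)%R])%E)
  (* quenched last-passage weights: for every positive environment a,
     (Y a i j) are independent exponential variables of rate a i under Q a *)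
  (d' : measure_display) (Xi : measurableType d')
  (Q : (int -> R) -> probability Xi R)
  (Y : (int -> R) -> int -> int -> Xi -> R)
  (Y_law : forall a : int -> R, (forall i, 0 < a i) ->
     (forall i j, measurable_fun setT (Y a i j)) /\
     mutually_independent (Q a) (fun p : int * int => Y a p.1 p.2) /\
     (forall i j, exp_law (Q a) (a i) (Y a i j)))
  (* tau: the deterministic almost-sure limit of T(xn, yn)/n *)
  (tau : R -> R -> R)
  (tau_def : forall x y : R, 0 <= y -> 0 <= x + y ->
     {ae P, forall w, {ae Q (fun i => alpha i w), forall xi,
        (fun n : nat => n%:R^-1 * lpp_T (fun i j => Y (fun i => alpha i w) i j xi)
                                          (scaled_pt x y n))
          @ \oo --> tau x y}})
  (rho : R)
  (rho_range : 1/2 - mu * r / 4 <= rho <= 1/2 + mu * r / 4) :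
  flux tau rho = (r / 4)%:E.
Proof.
exact: (flux_eq P alpha alpha_pos alpha_indep alpha_ident r mu r_def r_pos mu_def
  Q Y Y_law tau tau_def rho rho_range).
Qed.
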